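(* Let $X$ be a subshift (over a finite alphabet) given by an oracle $\psi$. Then the topological pressure function $P_{\rm top}(X,\cdot)$ is upper semi-computable on $C(X,\mathbb{R})$.
   Context: A subshift $X$ is a closed shift-invariant subset of $\mathcal{A}^{\mathbb{Z}}$, $\mathcal{A}$ a finite alphabet, $f$ the left shift; $\mathcal{L}(X,n)$ is the set of words of length $n$ occurring in points of $X$. The pressure of $\phi\in C(X,\mathbb{R})$ is $P_{\rm top}(X,\phi)=\lim_{n\to\infty}\frac1n\log\sum_{\tau\in\mathcal{L}(X,n)}\exp\big(\sup_{x\in[\tau]}\sum_{k=0}^{n-1}\phi(f^k(x))\big)$, $[\tau]=\{x\in X:x_0\cdots x_{n-1}=\tau\}$. An oracle for (the language of) $X$ is a function $\psi$ which on input $n$ returns the finite list of all admissible words of $X$ of length $2n+1$. An oracle for $\phi\in C(X,\mathbb{R})$ is a function $\chi$ which on input $n$ returns a rational-valued locally constant potential on $X$ (constant on the cylinders determined by the coordinates $-k,\dots,k$ for some $k$, given by $k$ and its values on these cylinders) with $\|\chi(n)-\phi\|_\infty<2^{-n}$. The function $P_{\rm top}(X,\cdot)$ is upper semi-computable on $C(X,\mathbb{R})$ if there is a Turing machine (with access to $\psi$) such that for every $\phi\in C(X,\mathbb{R})$ and every oracle $\chi$ for $\phi$, its outputs on inputs $(\chi,n)$, $n\in\mathbb{N}$, form a non-increasing sequence of rational numbers converging to $P_{\rm top}(X,\phi)$. *)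

(* Defs.v *)
(* MathComp / MathComp-Analysis *)
From HB Require Import structures.
From mathcomp Require Import all_boot all_order all_algebra.
From mathcomp Require Import all_classical all_reals all_analysis.

Set Implicit Arguments.
Unset Strict Implicit.
Unset Printing Implicit Defensive.

Import Order.TTheory GRing.Theory Num.Theory.
Import numFieldNormedType.Exports.

Local Open Scope classical_set_scope.
Local Open Scope ring_scope.

(** * Subshifts and topological pressure *)

Definition fullshift (A : finType) : topologicalType :=
  prod_topology (fun _ : int => discrete_topology A).

Definition shift_map (A : finType) (x : fullshift A) : fullshift A :=
  fun i => x (i + 1).

Definition subshift (A : finType) (X : set (fullshift A)) : Prop :=
  closed X /\ @shift_map A @` X = X.

(* The word x_i x_(i+1) ... x_(i+n-1). *)
Definition subword (A : finType) (x : fullshift A) (i : int) (n : nat) : seq A :=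
  mkseq (fun j => x (i + j%:Z)) n.

Definition admissible (A : finType) (X : set (fullshift A)) (w : seq A) : Prop :=
  exists2 x, X x & exists i : int, subword x i (size w) = w.

Definition cylinder (A : finType) (X : set (fullshift A)) (w : seq A) :
    set (fullshift A) :=
  [set x | X x /\ subword x 0 (size w) = w].

Definition birkhoff_sum (R : realType) (A : finType) (phi : fullshift A -> R)
    (n : nat) (x : fullshift A) : R :=
  \sum_(k < n) phi (iter k (@shift_map A) x).

Definition partition_sum (R : realType) (A : finType) (X : set (fullshift A))
    (phi : fullshift A -> R) (n : nat) : R :=
  \sum_(w : n.-tuple A | `[< admissible X w >])
    expR (sup (birkhoff_sum phi n @` cylinder X w)).

(* [lne] is the logarithm with lne 0 = -oo, so that the pressure is -oo on the
   empty subshift; it is finite on all other subshifts. *)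
Definition pressure (R : realType) (A : finType) (X : set (fullshift A))
    (phi : fullshift A -> R) : \bar R :=
  lim ((n%:R^-1)%:E * lne (partition_sum X phi n)%:E @[n --> \oo])%E.

(** * Oracles *)

Definition language_oracle (A : finType) (X : set (fullshift A))
    (psi : nat -> seq (seq A)) : Prop :=
  forall n w, w \in psi n <-> admissible X w /\ size w = n.*2.+1.

(* A rational locally constant potential: the radius k and the table of its
   values on the cylinders determined by the coordinates -k, ..., k. *)
Record locpot (A : finType) := LocPot {
  locpot_radius : nat;
  locpot_table : seq (seq A * rat)
}.

Definition locpot_on (A : finType) (X : set (fullshift A)) (p : locpot A) : Prop :=
  uniq (unzip1 (locpot_table p)) /\
  forall w, w \in unzip1 (locpot_table p) <->
    admissible X w /\ size w = (locpot_radius p).*2.+1.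

Definition locpot_val (A : finType) (p : locpot A) (x : fullshift A) : rat :=
  let w := subword x (- (locpot_radius p)%:Z) (locpot_radius p).*2.+1 in
  (nth ([::], 0) (locpot_table p) (index w (unzip1 (locpot_table p)))).2.

Definition potential_oracle (R : realType) (A : finType) (X : set (fullshift A))
    (phi : fullshift A -> R) (chi : nat -> locpot A) : Prop :=
  forall n, locpot_on X (chi n) /\
    sup [set `|ratr (locpot_val (chi n) x) - phi x| | x in X] < 2 ^- n.

(** * Turing machines with two oracles *)

(* Tape alphabet: the bits and the blank symbol [None]. *)
Notation symbol := (option bool).

Variant move := MoveLeft | Stay | MoveRight.

(* A two-way infinite tape with finitely many non-blank cells: the scanned
   symbol, the cells to its left (nearest first) and the cells to its right;
   all cells beyond the two lists are blank. *)
Record tape := Tape {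
  left_cells : seq symbol;
  scanned : symbol;
  right_cells : seq symbol
}.

Definition tape_move (m : move) (t : tape) : tape :=
  let: Tape l s r := t in
  match m with
  | MoveLeft => Tape (behead l) (head None l) (s :: r)
  | Stay => t
  | MoveRight => Tape (s :: l) (head None r) (behead r)
  end.

Definition tape_act (a : symbol * move) (t : tape) : tape :=
  tape_move a.2 (Tape (left_cells t) a.1 (right_cells t)).

(* The tape holding the bit string w, with the head on its first symbol. *)
Definition tape_load (w : seq bool) : tape :=
  let s := [seq Some b | b <- w] in Tape [::] (head None s) (behead s).

Fixpoint bits_upto_blank (s : seq symbol) : seq bool :=
  if s is Some b :: s' then b :: bits_upto_blank s' else [::].

(* The bit string from the head rightwards, up to the first blank. *)
Definition tape_read (t : tape) : seq bool :=
  bits_upto_blank (scanned t :: right_cells t).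

Variant oracle_name := Language | Potential.

Variant instruction (Q I : finType) :=
  | Halt
  | Act of Q & {ffun I -> symbol * move}
  | Ask of oracle_name & Q.
Arguments Halt {Q I}.

Record machine := Machine {
  state : finType;
  tape_index : finType;
  start : state;
  io_tape : tape_index;
  oracle_tape : tape_index;
  program : state -> {ffun tape_index -> symbol} -> instruction state tape_index
}.

Definition config (M : machine) : Type := state M * (tape_index M -> tape).

Definition update (I : finType) (T : Type) (f : I -> T) (i : I) (t : T) : I -> T :=
  fun j => if j == i then t else f j.

(* A query asks for the number m written in unary on the oracle tape, m being
   the number of consecutive 1s from the head rightwards; the tape is then
   replaced with one holding the answer. The next configuration is [None] in
   halting configurations. *)
Definition step (M : machine) (O : oracle_name -> nat -> seq bool)
    (c : config M) : option (config M) :=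
  let: (q, t) := c in
  match program q [ffun i => scanned (t i)] with
  | Halt => None
  | Act q' a => Some (q', fun i => tape_act (a i) (t i))
  | Ask o q' =>
      let m := find negb (tape_read (t (oracle_tape M))) in
      Some (q', update t (oracle_tape M) (tape_load (O o m)))
  end.

Definition initial (M : machine) (w : seq bool) : config M :=
  (start M, update (fun=> tape_load [::]) (io_tape M) (tape_load w)).

Definition computes (M : machine) (O : oracle_name -> nat -> seq bool)
    (w v : seq bool) : Prop :=
  exists t c,
    [/\ iter t (obind (step O)) (Some (initial M w)) = Some c,
        step O c = None & tape_read (c.2 (io_tape M)) = v].

(** * Encoding of finite objects as bit strings *)

(* n_1, ..., n_k is written 1^(n_1) 0 1^(n_2) 0 ... 1^(n_k) 0. *)
Definition code_nats (s : seq nat) : seq bool :=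
  flatten [seq rcons (nseq n true) false | n <- s].

(* Sign bit, numerator and denominator, in lowest terms. *)
Definition nats_of_rat (q : rat) : seq nat :=
  [:: nat_of_bool (q < 0); `|numq q|%N; `|denq q|%N].

(* Letters are numbered from 0 to #|A|-1. *)
Definition nats_of_word (A : finType) (w : seq A) : seq nat :=
  [seq nat_of_ord (enum_rank a) | a <- w].

(* Separators are not needed between words, as their common length is known:
   2n+1 in the answer of [psi] to the query n, and 2k+1 in the table of a
   potential of radius k, which is written first. *)
Definition code_words (A : finType) (ws : seq (seq A)) : seq bool :=
  code_nats (flatten [seq nats_of_word w | w <- ws]).

Definition code_locpot (A : finType) (p : locpot A) : seq bool :=
  code_nats (locpot_radius p ::
    flatten [seq nats_of_word e.1 ++ nats_of_rat e.2 | e <- locpot_table p]).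

Definition oracles (A : finType) (psi : nat -> seq (seq A))
    (chi : nat -> locpot A) (o : oracle_name) (n : nat) : seq bool :=
  match o with
  | Language => code_words (psi n)
  | Potential => code_locpot (chi n)
  end.

(** * Upper semi-computability *)

Definition upper_semicomputable (R : realType) (A : finType)
    (X : set (fullshift A)) (psi : nat -> seq (seq A))
    (P : (fullshift A -> R) -> \bar R) : Prop :=
  exists M : machine,
    forall phi : fullshift A -> R, {within X, continuous phi} ->
    forall chi : nat -> locpot A, potential_oracle X phi chi ->
    exists q : nat -> rat,
      [/\ forall n, computes M (oracles psi chi) (code_nats [:: n])
                      (code_nats (nats_of_rat (q n))),
          nonincreasing_seq q
        & (ratr (q n))%:E @[n --> \oo] --> P phi].

(* Main.v *)
Require Import Defs.
From mathcomp Require Import all_boot all_order all_algebra.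
From mathcomp Require Import all_classical all_reals all_analysis.
From mathcomp Require Import ring lra zify.

                                                                               
                                                                                
                                                             
                                                                                
                                                               
                                                                            
                                 
                                                                   
                                                                                
                                                                        
                                                                      
                                                    
                                                
                                                           
                                                                                
                                           

Set Implicit Arguments.
Unset Strict Implicit.
Unset Printing Implicit Defensive.

                                                         

(** Write Z(n) for the partition sums. A word of length m+n splits into admissible words of lengths
    m and n, and the supremum of a sum is at most the sum of the suprema, so ln Z(n) is subadditive.
    By Fekete's lemma the pressure p is both the limit and the infimum of ln Z(n)/n
    ([pressure_lim]). Hence an upper estimate of ln Z(L)/L at any single length L is one of p.

    At level j the machine uses the potential chi(j), of radius k, and words of a length L much
    larger than k. Table lookups give each word an integer [weight]; divided by 2^j it lies above
    S_L phi + L B on the cylinder, B being a bound of |phi|, with an excess O(L/(j+1)) ([weightP]).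
    Whether the sum of exp(weight/2^j) is below exp(L c/2^j) is tested in integers ([passes]), up to
    a factor e, thanks to e^(-y) <= (1 + y/M)^(-M) <= e^(1-y) ([passes_sound], [passes_complete]).
    The number [level] of failing c, divided by 2^j, is at least p + B ([level_ge]) and at most ln
    Z(L)/L + B + O(1/(j+1)) ([level_le]). A running minimum makes the sequence monotone, and it is
    squeezed to p ([approximation_cvg]).

    The Turing machine is obtained by compiling a small language of counter programs
    ([runs_compile]); the functions they compute are closed under bounded iteration
    ([computable_iteri]) and lookup in oracle answers. For the empty subshift the pressure is -oo
    and the machine outputs -n. *)

(** * Composable fragments of oracle Turing machines *)

Variant fragment_instruction (I : finType) (Q : Type) :=
  | FragAct of option Q & {ffun I -> symbol * move}
  | FragAsk of oracle_name & option Q.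

(** The target [None] of an instruction is the exit. A single exit and no halting instruction make
    fragments composable. *)
Record fragment (I : finType) := Fragment {
  frag_state : finType;
  frag_entry : frag_state;
  frag_program :
    frag_state -> {ffun I -> symbol} -> fragment_instruction I frag_state
}.

Section Fragments.
Variables (I : finType) (oracle_index : I).
Implicit Types (F G : fragment I) (t : I -> tape).

Definition retarget (Q Q' : Type) (g : option Q -> option Q')
    (i : fragment_instruction I Q) : fragment_instruction I Q' :=
  match i with
  | FragAct q a => FragAct (g q) a
  | FragAsk o q => FragAsk I o (g q)
  end.

Definition frag_seq F G : fragment I :=
  @Fragment I (frag_state F + frag_state G)%type (inl (frag_entry F))
    (fun q f => match q with
     | inl q => retarget (fun r => if r is Some r then Some (inl r)
                                   else Some (inr (frag_entry G)))
                         (frag_program q f)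
     | inr q => retarget (omap inr) (frag_program q f)
     end).

(** The state [None] evaluates the test without changing any tape. The body returns to it, since
    [retarget Some] sends the exit [None] of the body to [Some None]. *)
Definition frag_while (b : {ffun I -> symbol} -> bool) F : fragment I :=
  @Fragment I (option (frag_state F)) None
    (fun q f => match q with
     | Some q => retarget Some (frag_program q f)
     | None => FragAct (if b f then Some (Some (frag_entry F)) else None)
                       [ffun i => (f i, Stay)]
     end).

(** The scanned symbols decide both the action and whether to loop; the action is carried out on the
    last pass too. *)
Definition frag_repeat
    (p : {ffun I -> symbol} -> bool * {ffun I -> symbol * move}) : fragment I :=
  @Fragment I unit tt (fun q f => FragAct (if (p f).1 then Some tt else None) (p f).2).

Definition frag_act (a : {ffun I -> symbol} -> {ffun I -> symbol * move}) :=
  frag_repeat (fun f => (false, a f)).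

Definition frag_ask (o : oracle_name) : fragment I :=
  @Fragment I unit tt (fun q f => FragAsk I o None).

Definition scan t : {ffun I -> symbol} := [ffun i => scanned (t i)].

Variable O : oracle_name -> nat -> seq bool.

Definition query t : nat := find negb (tape_read (t oracle_index)).

Definition frag_step F (q : frag_state F) t : option (frag_state F) * (I -> tape) :=
  match frag_program q (scan t) with
  | FragAct q' a => (q', fun i => tape_act (a i) (t i))
  | FragAsk o q' => (q', update t oracle_index (tape_load (O o (query t))))
  end.

(** A derivation is a finite run to the exit, so termination is built in; step counts appear only in
    [runs_computes]. *)
Inductive reach F : option (frag_state F) -> (I -> tape) -> (I -> tape) -> Prop :=
  | reach_exit t : reach None t t
  | reach_step q t t' :
      reach (frag_step q t).1 (frag_step q t).2 t' -> reach (Some q) t t'.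

Definition runs F t t' := reach (Some (frag_entry F)) t t'.

(** The gluing principle: [H] simulates [F] step for step through [inj], and the exit of [F] becomes
    the place [g None], where the second run takes over. Sequences and loops are both instances. *)
Lemma reach_embed F H (inj : frag_state F -> frag_state H)
    (g : option (frag_state F) -> option (frag_state H)) r t t' t'' :
  (forall q, g (Some q) = Some (inj q)) ->
  (forall q f, frag_program (inj q) f = retarget g (frag_program q f)) ->
  reach r t t' -> reach (g None) t' t'' -> reach (g r) t t''.
Proof.
move=> gS gP; elim=> [//|q {}t {}t' _ IH /IH {}IH].
rewrite gS; apply: reach_step; move: IH; rewrite /frag_step gP.
by case: (frag_program q (scan t)).
Qed.

Lemma runs_seq F G t1 t2 t3 :
  runs F t1 t2 -> runs G t2 t3 -> runs (frag_seq F G) t1 t3.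
Proof.
move=> RF RG.
pose g r : option (frag_state (frag_seq F G)) :=
  if r is Some r then Some (inl r) else Some (inr (frag_entry G)).
apply: (@reach_embed F (frag_seq F G) inl g _ _ _ _ _ _ RF) => //.
apply: (@reach_embed G (frag_seq F G) inr (omap inr) _ _ _ _ _ _ RG) => //.
exact: reach_exit.
Qed.

Lemma tape_act_stay u : tape_act (scanned u, Stay) u = u.
Proof. by case: u. Qed.

Lemma runs_while_exit (b : {ffun I -> symbol} -> bool) F t : ~~ b (scan t) -> runs (frag_while b F) t t.
Proof.
move=> /negPf nb; apply: reach_step; rewrite /frag_step /= nb /=.
rewrite (_ : (fun i => _) = t) ?funeqE => [|i]; first exact: reach_exit.
by rewrite !ffunE tape_act_stay.
Qed.

Lemma runs_while_step (b : {ffun I -> symbol} -> bool) F t t' t'' : b (scan t) -> runs F t t' ->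
  runs (frag_while b F) t' t'' -> runs (frag_while b F) t t''.
Proof.
move=> bt RF RW; apply: reach_step; rewrite /frag_step /= bt /=.
rewrite (_ : (fun i => _) = t) ?funeqE => [|i]; last first.
  by rewrite !ffunE tape_act_stay.
exact: (@reach_embed F (frag_while b F) Some Some _ _ _ _ _ _ RF).
Qed.

Lemma runs_repeat_exit
    (p : {ffun I -> symbol} -> bool * {ffun I -> symbol * move}) t : ~~ (p (scan t)).1 ->
  runs (frag_repeat p) t (fun i => tape_act ((p (scan t)).2 i) (t i)).
Proof.
by move=> /negPf np; apply: reach_step; rewrite /frag_step /= np; exact: reach_exit.
Qed.

Lemma runs_repeat_step
    (p : {ffun I -> symbol} -> bool * {ffun I -> symbol * move}) t t' : (p (scan t)).1 ->
  runs (frag_repeat p) (fun i => tape_act ((p (scan t)).2 i) (t i)) t' ->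
  runs (frag_repeat p) t t'.
Proof. by move=> np R; apply: reach_step; rewrite /frag_step /= np. Qed.

Lemma runs_act a t : runs (frag_act a) t (fun i => tape_act (a (scan t) i) (t i)).
Proof. exact: (@runs_repeat_exit (fun f => (false, a f))). Qed.

Lemma runs_ask o t :
  runs (frag_ask o) t (update t oracle_index (tape_load (O o (query t)))).
Proof. by apply: reach_step; exact: reach_exit. Qed.

Definition machine_of (io_index : I) F : machine :=
  @Machine (option (frag_state F)) I (Some (frag_entry F)) io_index oracle_index
    (fun q f => match q with
     | None => Halt
     | Some q => match frag_program q f with
       | FragAct q' a => Act q' a
       | FragAsk o q' => Ask I o q'
       end
     end).

(** The exit becomes the halting state [None] of [machine_of]; induction on the run counts the
    steps. *)
Lemma runs_computes io_index F w t' :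
  runs F (update (fun=> tape_load [::]) io_index (tape_load w)) t' ->
  computes (machine_of io_index F) O w (tape_read (t' io_index)).
Proof.
set t := update _ _ _; rewrite /runs => R.
have [n En] : exists n, iter n (obind (@step (machine_of io_index F) O))
    (Some (Some (frag_entry F), t)) = Some (None, t').
  elim: R => [{}t|q {}t {}t' _ [n En]]; first by exists 0%N.
  exists n.+1; rewrite iterSr -En; congr (iter n _ _); rewrite /= /frag_step.
  by case: (frag_program q (scan t)).
by exists n, (None, t'); split.
Qed.

End Fragments.

                                                

                                                                           
                                                                              
                                                                            
                                           
(** * Counter programs and their compilation to Turing machines *)

Inductive command :=
  | Inc of nat
  | Dec of nat
  | Seq of command & command
  | While of nat & command
  | AskList of oracle_name & nat
  | Pop of nat & nat.

Definition upd (s : nat -> nat) (x v : nat) : nat -> nat :=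
  fun y => if y == x then v else s y.

Definition list_oracle := oracle_name -> nat -> seq nat.

(** The list is the unread part of the latest oracle answer. The second register of [Pop] detects
    its end: it grows exactly when there was an entry to read. *)
Inductive exec (O : list_oracle) :
    command -> (nat -> nat) -> seq nat -> (nat -> nat) -> seq nat -> Prop :=
  | exec_inc x s l : exec O (Inc x) s l (upd s x (s x).+1) l
  | exec_dec x s l : 0 < s x -> exec O (Dec x) s l (upd s x (s x).-1) l
  | exec_seq c c' s l s' l' s'' l'' :
      exec O c s l s' l' -> exec O c' s' l' s'' l'' ->
      exec O (Seq c c') s l s'' l''
  | exec_while_exit x c s l : s x = 0 -> exec O (While x c) s l s l
  | exec_while_step x c s l s' l' s'' l'' :
      0 < s x -> exec O c s l s' l' -> exec O (While x c) s' l' s'' l'' ->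
      exec O (While x c) s l s'' l''
  | exec_ask o x s l : exec O (AskList o x) s l (upd s x 0) (O o (s x))
  | exec_pop x y s n l : x != y ->
      exec O (Pop x y) s (n :: l) (upd (upd s x (s x + n)) y (s y).+1) l
  | exec_pop_nil x y s : exec O (Pop x y) s [::] s [::].

Fixpoint command_bound (c : command) : nat :=
  match c with
  | Inc x | Dec x | AskList _ x => x
  | Seq c c' => maxn (command_bound c) (command_bound c')
  | While x c => maxn x (command_bound c)
  | Pop x y => maxn x y
  end.

Section Compilation.
Variable m : nat.

Notation index := (bool + 'I_m.+1)%type.
Definition io : index := inl true.
Definition orc : index := inl false.
Definition reg (x : nat) : index := inr (inord x).

Definition local_act (g : index -> symbol -> symbol * move)
    (f : {ffun index -> symbol}) : {ffun index -> symbol * move} :=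
  [ffun i => g i (f i)].

Definition keep (d : move) (a : symbol) : symbol * move := (a, d).

                                                                              
                                                           
(** The value is the distance of the head from a marker [Some false], so counting moves the head and
    writes nothing new. The [r] blanks on the right are those that head moves have made explicit. *)
Definition counter (n r : nat) : tape :=
  Tape (if n is n'.+1 then rcons (nseq n' None) (Some false) else [::])
       (if n is 0 then Some false else None) (nseq r None).

Definition nonzero (x : nat) (f : {ffun index -> symbol}) : bool :=
  f (reg x) != Some false.

Definition frag_emit (j : index) (x : nat) : fragment index :=
  frag_while (nonzero x) (frag_act (local_act (fun i a =>
    if i == j then (Some true, MoveLeft)
    else if i == reg x then keep MoveLeft a else keep Stay a))).

Definition frag_write (j : index) (a : symbol) (d : move) : fragment index :=
  frag_act (local_act (fun i b => if i == j then (a, d) else keep Stay b)).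

Definition frag_move (j : index) (d : move) : fragment index :=
  frag_act (local_act (fun i b => if i == j then keep d b else keep Stay b)).

(** An entry n is coded 1^n 0: each 1 advances [x]; the 0 advances [y] and ends the loop. A blank
    means that the list is exhausted, and nothing moves. *)
Definition frag_pop (x y : nat) : fragment index :=
  frag_repeat (fun f => (f orc == Some true, local_act (fun i a =>
    if f orc == None then keep Stay a
    else if i == orc then keep MoveRight a
    else if i == reg (if f orc == Some true then x else y) then keep MoveRight a
    else keep Stay a) f)).

(** A query is written from right to left: a blank to end it, then as many 1s as [x] holds while [x]
    returns to zero. The head finally steps back to the right, onto the start of the query. *)
Fixpoint compile (c : command) : fragment index :=
  match c with
  | Inc x => frag_move (reg x) MoveRight
  | Dec x => frag_move (reg x) MoveLeft
  | Seq c c' => frag_seq (compile c) (compile c')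
  | While x c => frag_while (nonzero x) (compile c)
  | AskList o x =>
      frag_seq (frag_write orc None MoveLeft)
      (frag_seq (frag_emit orc x)
      (frag_seq (frag_move orc MoveRight) (frag_ask _ o)))
  | Pop x y => frag_pop x y
  end.

(** The cells on the left are unconstrained: they hold bits already read. *)
Definition holds_list (l : seq nat) (t : tape) : Prop :=
  let s := [seq Some b | b <- code_nats l] in
  scanned t = head None s /\ right_cells t = behead s.

Definition represents (s : nat -> nat) (l : seq nat) (t : index -> tape) : Prop :=
  (forall x, x <= m -> exists r, t (reg x) = counter (s x) r) /\
  holds_list l (t orc).

Lemma counter_right n r :
  tape_act (keep MoveRight (scanned (counter n r))) (counter n r)
  = counter n.+1 r.-1.
Proof. by case: n r => [|n] [|r]. Qed.

Lemma counter_left n r :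
  tape_act (keep MoveLeft (scanned (counter n.+1 r))) (counter n.+1 r)
  = counter n r.+1.
Proof. by case: n. Qed.

Lemma scanned_counter n r : (scanned (counter n r) != Some false) = (0 < n).
Proof. by case: n. Qed.

Lemma reg_inj x y : x <= m -> y <= m -> (reg x == reg y) = (x == y).
Proof.
move=> xm ym; apply/eqP/eqP => [[/(congr1 val)]|-> //].
by rewrite /= !inordK.
Qed.

Lemma nonzeroE x s l t : x <= m -> represents s l t ->
  nonzero x (scan t) = (0 < s x).
Proof. by move=> xm [/(_ x xm)[r E] _]; rewrite /nonzero ffunE E scanned_counter. Qed.

Variable O : list_oracle.
Let bits o n := code_nats (O o n).
Notation runs := (@runs index orc bits).

Lemma runs_local g (t : index -> tape) :
  runs (frag_act (local_act g)) t (fun i => tape_act (g i (scanned (t i))) (t i)).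
Proof.
rewrite (_ : (fun i => _) = fun i => tape_act (local_act g (scan t) i) (t i)).
  exact: runs_act.
by rewrite funeqE => i; rewrite !ffunE.
Qed.

Lemma runs_move j d t : runs (frag_move j d) t
  (update t j (tape_act (keep d (scanned (t j))) (t j))).
Proof.
rewrite (_ : update _ _ _ = fun i => tape_act ((fun i b => if i == j then keep d b
  else keep Stay b) i (scanned (t i))) (t i)); first exact: runs_local.
rewrite funeqE => i; rewrite /update; case: eqP => [-> //|_].
by rewrite tape_act_stay.
Qed.

Lemma runs_write j a d t : runs (frag_write j a d) t
  (update t j (tape_act (a, d) (t j))).
Proof.
rewrite (_ : update _ _ _ = fun i => tape_act ((fun i b => if i == j then (a, d)
  else keep Stay b) i (scanned (t i))) (t i)); first exact: runs_local.
rewrite funeqE => i; rewrite /update; case: eqP => [-> //|_].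
by rewrite tape_act_stay.
Qed.

                                                                                 
Lemma runs_emit j x n r (t : index -> tape) : j != reg x ->
  t (reg x) = counter n r ->
  exists t', [/\ runs (frag_emit j x) t t',
    t' (reg x) = counter 0 (r + n),
    right_cells (t' j) = nseq n (Some true) ++ right_cells (t j)
    & forall i, i != j -> i != reg x -> t' i = t i].
Proof.
move=> jx; elim: n r t => [|n IH] r t E.
  exists t; split=> //; last by rewrite addn0.
  by apply: runs_while_exit; rewrite /nonzero ffunE E.
pose t1 := fun i => tape_act (if i == j then (Some true, MoveLeft)
    else if i == reg x then keep MoveLeft (scanned (t i))
    else keep Stay (scanned (t i))) (t i).
have t1x : t1 (reg x) = counter n r.+1.
  by rewrite /t1 eq_sym (negPf jx) eqxx E counter_left.
have [t' [R Ex Ej Ei]] := IH _ _ t1x.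
exists t'; split => //; last first.
- by move=> i ij ix; rewrite Ei // /t1 (negPf ij) (negPf ix) tape_act_stay.
- rewrite Ej /t1 eqxx /=; case: (t j) => /= _ _ rj.
  by rewrite -cat_rcons -[rcons _ _]cats1 -[[:: _]]/(nseq 1 _) -nseqD addn1.
- by rewrite Ex addSnnS.
apply: runs_while_step R; first by rewrite /nonzero ffunE E.
exact: runs_local.
Qed.

Lemma represents_upd s l l' t t' x v r : x <= m -> represents s l t ->
  t' (reg x) = counter v r ->
  (forall y, y <= m -> y != x -> t' (reg y) = t (reg y)) ->
  holds_list l' (t' orc) ->
  represents (upd s x v) l' t'.
Proof.
move=> xm [regs _] Ex Ey Hl; split=> // y ym; rewrite /upd.
case: eqVneq => [->|yx]; first by exists r.
by rewrite Ey //; exact: regs.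
Qed.

Lemma holds_list_next l l' t a : behead (code_nats l) = code_nats l' ->
  holds_list l t -> holds_list l' (tape_act (a, MoveRight) t).
Proof.
by case: t => lt st rt; rewrite /holds_list => <- [/= _ ->]; rewrite -!behead_map.
Qed.

(** One pass of the loop of [frag_pop]. Dropping a leading 1 turns the code of n+1 :: l into that of
    n :: l, and dropping a leading 0 turns that of 0 :: l into that of l; [l'] covers both cases. *)
Lemma runs_pop_act x y s l l' t (b := nosimpl (head false (code_nats l)))
    (z := if b then x else y) : z <= m ->
  represents s l t -> l != [::] -> behead (code_nats l) = code_nats l' ->
  let t' := fun i => tape_act (local_act (fun i a =>
    if scan t orc == None then keep Stay a
    else if i == orc then keep MoveRight a
    else if i == reg (if scan t orc == Some true then x else y)
    then keep MoveRight a else keep Stay a) (scan t) i) (t i) in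
  [/\ scan t orc == Some true = b,
      represents (upd s z (s z).+1) l' t' & t' io = t io].
Proof.
move=> zm rep l0 El t'.
have Eb : scan t orc = Some b.
  rewrite ffunE; case: rep => _ [-> _].
  have : head false (code_nats l) = b by [].
  by case: (l) l0 => // -[|n] ? _ /= <-.
have E i : t' i = if i == orc then tape_act (keep MoveRight (scanned (t i))) (t i)
    else if i == reg z then tape_act (keep MoveRight (scanned (t i))) (t i)
    else t i.
  rewrite /t' !ffunE -[scanned (t orc)](ffunE (fun i => scanned (t i))).
  rewrite -/(scan t) Eb /= -/z.
  have -> : (Some b == Some true) = b by case: (b).
  rewrite -/z; case: (i == orc) => //; case: (i == reg z) => //.
  by rewrite tape_act_stay.
split; first by rewrite Eb; case: (b).
- have [r Er] := rep.1 z zm.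
  apply: (represents_upd (r := r.-1) _ rep) => //.
  + by rewrite E /= eqxx Er counter_right.
  + by move=> w wm wz; rewrite E /= reg_inj // (negPf wz).
  + by rewrite E eqxx; apply: holds_list_next El _; case: rep.
- by rewrite E.
Qed.

Lemma runs_pop x y n s l t : x <= m -> y <= m -> x != y ->
  represents s (n :: l) t ->
  exists t', [/\ runs (frag_pop x y) t t',
    represents (upd (upd s x (s x + n)) y (s y).+1) l t' & t' io = t io].
Proof.
move=> xm ym xy; elim: n s t => [|n IH] s t rep.
  have := @runs_pop_act x y s (0 :: l) l t ym rep isT erefl.
  set t' := (fun i => _) => -[b rep' Eio]; exists t'; split=> //.
  - by apply: runs_repeat_exit; rewrite /= b.
  - rewrite addn0; congr (represents _ _ _): rep'; rewrite funeqE => z.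
    by rewrite /upd; case: eqP => // _; case: eqP => // ->.
have := @runs_pop_act x y s (n.+1 :: l) (n :: l) t xm rep isT erefl.
set t1 := (fun i => _) => -[b rep' Eio].
have [t' [R rep'' Eio']] := IH _ _ rep'.
exists t'; split; last by rewrite Eio' Eio.
- by apply: runs_repeat_step R; rewrite /= b.
- congr (represents _ _ _): rep''; rewrite funeqE => z.
  rewrite /upd eqxx addSnnS (eq_sym y x) (negPf xy).
  by case: eqP => // _; case: eqP.
Qed.

(** Induction on the execution. As the tape [io] stays untouched, the input can be consumed
    beforehand and the output written afterwards. *)
Lemma runs_compile c s l s' l' t : exec O c s l s' l' ->
  command_bound c <= m -> represents s l t ->
  exists t', [/\ runs (compile c) t t', represents s' l' t' & t' io = t io].
Proof.
move=> E; elim: E t => {c s l s' l'}.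
- move=> x s l t /= xm rep; eexists; split; first exact: runs_move.
  + have [r Er] := rep.1 x xm.
    apply: (represents_upd (r := r.-1) _ rep) => //.
    * by rewrite /update eqxx Er counter_right.
    * by move=> w wm wz; rewrite /update reg_inj // (negPf wz).
    * by case: rep.
  + by [].
- move=> x s l x0 t /= xm rep; eexists; split; first exact: runs_move.
  + have [r] := rep.1 x xm; rewrite -(prednK x0) => Er.
    apply: (represents_upd (r := r.+1) _ rep) => //.
    * by rewrite /update eqxx Er counter_left.
    * by move=> w wm wz; rewrite /update reg_inj // (negPf wz).
    * by case: rep.
  + by [].
- move=> c c' s l s' l' s'' l'' _ IH _ IH' t; rewrite geq_max => /andP[cm cm'] rep.
  have [t' [R rep' Eio]] := IH _ cm rep.
  have [t'' [R' rep'' Eio']] := IH' _ cm' rep'.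
  by exists t''; split; [exact: runs_seq R R'|by []|rewrite Eio' Eio].
- move=> x c s l x0 t; rewrite geq_max => /andP[xm cm] rep.
  exists t; split=> //; apply: runs_while_exit.
  by rewrite (nonzeroE xm rep) x0.
- move=> x c s l s' l' s'' l'' x0 _ IH _ IH' t.
  move=> cwm; have := cwm; rewrite geq_max => /andP[xm cm] rep.
  have [t' [R rep' Eio]] := IH _ cm rep.
  have [t'' [R' rep'' Eio']] := IH' _ cwm rep'.
  exists t''; split=> //; last by rewrite Eio' Eio.
  by apply: runs_while_step R R'; rewrite (nonzeroE xm rep).
- move=> o x s l t /= xm rep.
  have [r Er] := rep.1 x xm.
  set t1 := update t orc (tape_act (None, MoveLeft) (t orc)).
  have Er1 : t1 (reg x) = counter (s x) r by rewrite /t1 /update Er.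
  have [t2 [R2 E2x E2o E2]] := @runs_emit orc _ _ _ t1 isT Er1.
  set t3 := update t2 orc (tape_act (keep MoveRight (scanned (t2 orc))) (t2 orc)).
  (* The 1s just emitted are followed by the blank written at the start, so exactly [s x] is read in
     unary. *)
  have q3 : query orc t3 = s x.
    rewrite /t3 /query {1}/update eqxx; move: E2o; rewrite /t1 /update eqxx.
    case: (t orc) => lt st rt; case: (t2 orc) => l2 s2 r2 /= ->.
    rewrite /tape_read /=; case: (s x) => [|n] //=.
    by congr _.+1; elim: n => //= n ->.
  set t4 := update t3 orc (tape_load (bits o (s x))).
  exists t4; split.
  + apply: runs_seq; first exact: runs_write.
    apply: runs_seq; first exact: R2.
    apply: runs_seq; first exact: runs_move.
    by rewrite /t4 -q3; exact: runs_ask.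
  + apply: (represents_upd (r := (r + s x)) _ rep) => //.
    * by move=> y ym yx; rewrite /t4 /t3 /update /= E2 // reg_inj.
  + by rewrite /t4 /t3 /update /= E2.
- move=> x y s n l xy t /=; rewrite geq_max => /andP[xm ym] rep.
  exact: runs_pop.
- move=> x y s t _ rep; exists t; split=> //.
  have Eb : scan t orc = None by rewrite ffunE; case: rep => _ [-> _].
  have := @runs_repeat_exit index orc bits (fun f => (f orc == Some true, local_act (fun i a =>
    if f orc == None then keep Stay a
    else if i == orc then keep MoveRight a
    else if i == reg (if f orc == Some true then x else y) then keep MoveRight a
    else keep Stay a) f)) t.
  rewrite /= Eb => /(_ isT); congr (runs _ _ _); rewrite funeqE => i.
  by rewrite !ffunE /= tape_act_stay.
Qed.

Definition frag_init : fragment index :=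
  frag_act (local_act (fun i a =>
    if i is inr _ then (Some false, Stay) else keep Stay a)).

(** The final 0 of the input is replaced by a blank, which will end the output written leftwards
    from there. *)
Definition frag_input : fragment index :=
  frag_repeat (fun f => (f io == Some true, local_act (fun i a =>
    if i == io then if f io == Some true then keep MoveRight a else (None, MoveLeft)
    else if (f io == Some true) && (i == reg 0) then keep MoveRight a
    else keep Stay a) f)).

                                               
Definition frag_output (x : nat) : fragment index :=
  frag_seq (frag_write io (Some false) MoveLeft) (frag_emit io x).

(** The head stands just left of the output, ready to prepend a number; remains of the input may lie
    under it and further left. *)
Definition outputs (l : seq nat) (t : tape) : Prop :=
  exists r, right_cells t = [seq Some b | b <- code_nats l] ++ None :: r.

Lemma runs_input n s t : represents s [::] t ->
  scanned (t io) :: right_cells (t io) = [seq Some b | b <- code_nats [:: n]] ->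
  exists t', [/\ runs frag_input t t',
    represents (upd s 0 (s 0 + n)) [::] t' & outputs [::] (t' io)].
Proof.
elim: n s t => [|n IH] s t rep.
  case Eio : (t io) => [lt st rt] /= [Est Ert].
  exists (fun i => if i == io then tape_act (None, MoveLeft) (t io) else t i).
  split.
  - have := @runs_repeat_exit index orc bits (fun f => (f io == Some true, local_act (fun i a =>
      if i == io then if f io == Some true then keep MoveRight a else (None, MoveLeft)
      else if (f io == Some true) && (i == reg 0) then keep MoveRight a
      else keep Stay a) f)) t.
    rewrite /= [scan t io]ffunE Eio Est => /(_ isT); congr (runs _ _ _).
    rewrite funeqE => i; rewrite !ffunE /=; case: eqP => [->|_].
      by rewrite Eio Est.
    by rewrite tape_act_stay.
  - have [r Er] := rep.1 0 isT.
    apply: (represents_upd (r := r) _ rep) => //=; first by rewrite addn0.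
    by case: rep.
  - by exists rt; rewrite eqxx Eio /= Ert.
case Eio : (t io) => [lt st rt] /= [Est Ert].
pose t1 i := if i == io then tape_act (keep MoveRight (scanned (t i))) (t i)
  else if i == reg 0 then tape_act (keep MoveRight (scanned (t i))) (t i) else t i.
have rep1 : represents (upd s 0 (s 0).+1) [::] t1.
  have [r Er] := rep.1 0 isT.
  apply: (represents_upd (r := r.-1) _ rep) => //.
  - by rewrite /t1 /= eqxx Er counter_right.
  - by move=> y ym y0; rewrite /t1 /= reg_inj // (negPf y0).
  - by case: rep.
have [|t' [R rep' out]] := IH _ _ rep1.
  rewrite /t1 eqxx Eio /= Ert; case: (n) => [|k] //=.
exists t'; split => //; last first.
  congr (represents _ _ _): rep'; rewrite funeqE => z.
  by rewrite /upd eqxx addSnnS; case: eqP.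
apply: runs_repeat_step; first by rewrite /= ffunE Eio Est.
congr (runs _ _ _): R; rewrite funeqE => i; rewrite !ffunE Eio Est /= /t1.
case: (eqVneq i io) => [->|_]; first by rewrite Eio Est.
by case: eqP => // _; rewrite tape_act_stay.
Qed.

Lemma runs_output x n l r (t : index -> tape) :
  t (reg x) = counter n r -> outputs l (t io) ->
  exists t', [/\ runs (frag_output x) t t', outputs (n :: l) (t' io)
    & forall y, y <= m -> x <= m -> y != x -> t' (reg y) = t (reg y)].
Proof.
move=> Ex [u Eu].
set t1 := update t io (tape_act (Some false, MoveLeft) (t io)).
have E1x : t1 (reg x) = counter n r by rewrite /t1 /update Ex.
have [t2 [R2 E2x E2o E2]] := @runs_emit io _ _ _ t1 isT E1x.
exists t2; split.
- by apply: runs_seq R2; exact: runs_write.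
- exists u; rewrite E2o /t1 /update eqxx.
  case: (t io) Eu => lt st rt /= ->.
  by rewrite /code_nats /= map_cat map_rcons map_nseq cat_rcons -catA.
- by move=> y ym xm yx; rewrite E2 // reg_inj.
Qed.

(** The output grows leftwards, hence the order 3, 2, 1 and the last move onto its first symbol. *)
Definition program_machine (c : command) : machine :=
  @machine_of index orc io
    (frag_seq frag_init (frag_seq frag_input (frag_seq (compile c)
      (frag_seq (frag_output 3) (frag_seq (frag_output 2)
        (frag_seq (frag_output 1) (frag_move io MoveRight))))))).

Lemma tape_read_outputs l t :
  outputs l t -> tape_read (tape_act (keep MoveRight (scanned t)) t) = code_nats l.
Proof.
move=> [r]; case: t => lt st rt /= ->.
rewrite /tape_read /=; case: (code_nats l) => //= b w.
by congr (_ :: _); elim: w => //= b' w ->.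
Qed.

Lemma program_computes c n s l : command_bound c <= m -> 3 <= m ->
  exec O c (upd (fun=> 0) 0 n) [::] s l ->
  computes (program_machine c) bits (code_nats [:: n])
    (code_nats [:: s 1; s 2; s 3]).
Proof.
move=> cm m3 E.
set t0 := update (fun=> tape_load [::]) io (tape_load (code_nats [:: n])).
pose t1 i := if i is inr _ then counter 0 0 else t0 i.
have R1 : runs frag_init t0 t1.
  rewrite (_ : t1 = fun i => tape_act ((fun i a => if i is inr _ then (Some false, Stay)
    else keep Stay a) i (scanned (t0 i))) (t0 i)); first exact: runs_local.
  by rewrite funeqE => -[b|i] //=; rewrite tape_act_stay.
have rep1 : represents (fun=> 0) [::] t1 by split=> // x xm; exists 0.
have io1 : scanned (t1 io) :: right_cells (t1 io) = [seq Some b | b <- code_nats [:: n]].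
  by rewrite /t1 /t0 /update eqxx; case: (n).
have [t2 [R2 rep2 io2]] := runs_input rep1 io1.
have [t3 [R3 [rep3 _] io3]] := runs_compile E cm rep2.
have {}io3 : outputs [::] (t3 io) by rewrite io3.
have [r3 E3] := rep3 3 m3.
have [t4 [R4 io4 reg4]] := runs_output E3 io3.
have m2 : 2 <= m := ltnW m3.
have m1 : 1 <= m := ltnW m2.
have [r2 E2] := rep3 2 m2; rewrite -reg4 // in E2.
have [t5 [R5 io5 reg5]] := runs_output E2 io4.
have [r1 E1] := rep3 1 m1; rewrite -reg4 // -reg5 // in E1.
have [t6 [R6 io6 _]] := runs_output E1 io5.
rewrite -(tape_read_outputs io6).
rewrite -[tape_act _ _](_ : update t6 io
  (tape_act (keep MoveRight (scanned (t6 io))) (t6 io)) io = _); last first.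
  by rewrite /update eqxx.
apply: runs_computes; do 6!(apply: runs_seq; first eassumption).
exact: runs_move.
Qed.

End Compilation.

                                                  

                                                                           
                                                                     
(** * Functions computed by counter programs *)

(** A stack discipline: [d] is the first free register, and the command changes no other in the end,
    so commands for subexpressions can be chained at [d], [d.+1], and so on. The command is fixed
    before the oracle. The final list is arbitrary, as each query starts a new one. *)
Definition computable (F : list_oracle -> seq nat -> nat) : Prop :=
  forall vs d, all (fun v => v < d) vs ->
  exists c, forall O s l, (forall i, d <= i -> s i = 0) ->
  exists l', exec O c s l (upd s d (F O [seq s v | v <- vs])) l'.

Ltac solve_upd := rewrite funeqE /upd; let z := fresh "z" in intro z;
  repeat (case: eqP => ?; subst; try lia); try done; try lia.

Lemma map_upd (s : nat -> nat) vs d x v : all (fun v => v < d) vs -> d <= x ->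
  [seq upd s x v i | i <- vs] = [seq s i | i <- vs].
Proof.
move=> /allP vsd dx; apply/eq_in_map => i /vsd id.
by rewrite /upd; case: eqP => // E; move: id; rewrite E ltnNge dx.
Qed.

Lemma all_ltnW (vs : seq nat) d d' : d <= d' ->
  all (fun v => v < d) vs -> all (fun v => v < d') vs.
Proof. by move=> dd'; apply: sub_all => v /leq_trans; apply. Qed.

Ltac eval_upd := rewrite /upd; repeat (case: eqP => ?; subst; try lia).

Lemma exec_eq O c s l s' s'' l' :
  exec O c s l s' l' -> s' = s'' -> exec O c s l s'' l'.
Proof. by move=> E <-. Qed.

Lemma exec_eqs O c s s' l s'' l' :
  s = s' -> exec O c s' l s'' l' -> exec O c s l s'' l'.
Proof. by move=> ->. Qed.

Section Commands.
Variable O : list_oracle.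

Definition clear x := While x (Dec x).

Lemma exec_clear x s l : exec O (clear x) s l (upd s x 0) l.
Proof.
move E : (s x) => n; elim: n s E => [|n IH] s E.
  rewrite (_ : upd s x 0 = s); first exact: exec_while_exit.
  by solve_upd.
apply: exec_while_step; first by rewrite E.
  by apply: exec_dec; rewrite E.
rewrite (_ : upd s x 0 = upd (upd s x (s x).-1) x 0); last by solve_upd.
by apply: IH; rewrite /upd eqxx E.
Qed.

Definition transfer x y := While x (Seq (Dec x) (Inc y)).

Lemma exec_transfer x y s l : x != y ->
  exec O (transfer x y) s l (upd (upd s x 0) y (s y + s x)) l.
Proof.
move=> xy; move E : (s x) => n; elim: n s E => [|n IH] s E.
  rewrite (_ : upd _ _ _ = s); first exact: exec_while_exit.
  by solve_upd.
apply: exec_while_step; first by rewrite E.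
  by apply: exec_seq; [apply: exec_dec; rewrite E|exact: exec_inc].
set s1 := upd _ y _.
rewrite (_ : upd _ _ _ = upd (upd s1 x 0) y (s1 y + n)).
  by apply: IH; rewrite /s1 /upd eqxx (negPf xy) E.
by move/eqP: xy => xy; rewrite /s1; solve_upd.
Qed.

(** Emptying a register is the only way to read it, so two copies are made and one is poured
    back. *)
Definition copy x y z :=
  Seq (While x (Seq (Dec x) (Seq (Inc y) (Inc z)))) (transfer z x).

Lemma exec_copy x y z s l : x != y -> x != z -> y != z -> s y = 0 -> s z = 0 ->
  exec O (copy x y z) s l (upd s y (s x)) l.
Proof.
move=> xy xz yz y0 z0.
suff H n s' : s' x = n -> exec O (While x (Seq (Dec x) (Seq (Inc y) (Inc z)))) s' l
    (upd (upd (upd s' x 0) y (s' y + n)) z (s' z + n)) l.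
  apply: exec_seq; first exact: H.
  have := exec_transfer _ l; set s1 := upd _ z _ => /(_ z x s1).
  rewrite eq_sym xz => /(_ isT); congr (exec _ _ _ _ _ _).
  move/eqP: xy => xy; move/eqP: xz => xz; move/eqP: yz => yz.
  by rewrite /s1; solve_upd.
move/eqP: xy => xy; move/eqP: xz => xz; move/eqP: yz => yz.
elim: n s' => [|n IH] s' E.
  rewrite (_ : upd _ _ _ = s'); first exact: exec_while_exit.
  by solve_upd.
apply: exec_while_step; first by rewrite E.
  apply: exec_seq; first by apply: exec_dec; rewrite E.
  by apply: exec_seq; exact: exec_inc.
set s1 := upd _ z _.
rewrite (_ : upd _ _ _ = upd (upd (upd s1 x 0) y (s1 y + n)) z (s1 z + n)).
  by apply: IH; rewrite /s1; rewrite /upd; repeat (case: eqP => ?; try lia).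
by rewrite /s1; solve_upd.
Qed.

End Commands.

Lemma computable_const n : computable (fun _ _ => n).
Proof.
move=> vs d _; elim: n => [|n [c IH]].
  (* [Inc] followed by [Dec] serves as the command that does nothing. *)
  exists (Seq (Inc d) (Dec d)) => O s l s0; exists l.
  apply: exec_seq; first exact: exec_inc.
  rewrite [X in exec _ _ _ _ X _](_ : _ =
    upd (upd s d (s d).+1) d (upd s d (s d).+1 d).-1); last first.
    by have ? := s0 d (leqnn d); solve_upd.
  by apply: exec_dec; rewrite /upd eqxx.
exists (Seq c (Inc d)) => O s l s0; have [l' E] := IH O s l s0.
exists l'; apply: exec_seq; first exact: E.
rewrite [X in exec _ _ _ _ X _](_ : _ = upd (upd s d n) d (upd s d n d).+1); last first.
  by solve_upd.
exact: exec_inc.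
Qed.

Lemma computable_nth i : computable (fun _ e => nth 0 e i).
Proof.
move=> vs d vsd; case: (ltnP i (size vs)) => [ivs|]; last first.
  have [c H] := @computable_const 0 vs d vsd.
  move=> vsi; exists c => O s l s0; have [l' E] := H O s l s0.
  by exists l'; rewrite nth_default // size_map.
have vd : nth 0 vs i < d by apply: (allP vsd); rewrite mem_nth.
exists (copy (nth 0 vs i) d d.+1) => O s l s0; exists l.
rewrite (nth_map 0) //; apply: exec_copy; rewrite ?s0 //; lia.
Qed.

Lemma computable_head : computable (fun _ e => head 0 e).
Proof.
rewrite (_ : (fun _ _ => _) = fun _ e => nth 0 e 0); first exact: computable_nth.
by rewrite funeq2E => _ [].
Qed.

Lemma computable_behead F :
  computable F -> computable (fun O e => F O (behead e)).
Proof.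
move=> H vs d vsd; have [|c E] := H (behead vs) d.
  by apply/allP => v /mem_behead /(allP vsd).
by exists c => O s l /(E O s l); rewrite behead_map.
Qed.

(** Bounded iteration is the source of the arithmetic below. Register [d] counts down, [d.+1]
    accumulates, [d.+2] is the index, and the body leaves its value in [d.+3]. *)
Lemma computable_iteri N A C : computable N -> computable A -> computable C ->
  computable (fun O e => iteri (N O e) (fun i acc => C O [:: acc, i & e]) (A O e)).
Proof.
move=> HN HA HC vs d vsd.
have [cN EN] := HN vs d vsd.
have [cA EA] := HA vs d.+1 (all_ltnW (leqnSn d) vsd).
have vsd3 : all (fun v => v < d.+3) [:: d.+1, d.+2 & vs].
  by rewrite /= ltnSn ltnW //= (all_ltnW _ vsd) // ltnW // ltnW.
have [cC EC] := HC _ _ vsd3.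
exists (Seq cN (Seq cA (Seq
  (While d (Seq (Dec d) (Seq cC (Seq (clear d.+1) (Seq (transfer d.+3 d.+1) (Inc d.+2))))))
  (Seq (clear d.+2) (transfer d.+1 d))))) => O s l s0.
set e := map s vs; set n := N O e; set a := A O e.
set f := fun i acc => _.
have [l1 E1] := EN O s l s0.
have s0' : forall i, d.+1 <= i -> upd s d n i = 0.
  by move=> i di; rewrite /upd; case: eqP => ?; [lia|apply: s0; lia].
have [l2 E2] := EA O (upd s d n) l1 s0'.
pose S k i acc := upd (upd (upd s d k) d.+1 acc) d.+2 i.
set W := While d _.
suff loop k i l0 : exists l3,
    exec O W (S k i (iteri i f a)) l0 (S 0 (i + k) (iteri (i + k) f a)) l3.
  have [l3 E3] := loop n 0 l2; rewrite add0n in E3.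
  exists l3; apply: exec_seq; first exact: E1.
  apply: exec_seq; first exact: E2.
  rewrite (map_upd _ _ vsd) // -/e -/a.
  have ? : s d.+1 = 0 by apply: s0; lia.
  have ? : s d.+2 = 0 by apply: s0; lia.
  apply: exec_seq.
    rewrite (_ : upd _ _ a = S n 0 (iteri 0 f a)); first exact: E3.
    by rewrite /S /=; solve_upd.
  apply: exec_seq; first exact: exec_clear.
  apply: exec_eq; first by apply: exec_transfer; apply/eqP; lia.
  by rewrite /S /=; solve_upd.
elim: k i l0 => [|k IH] i l0.
  by exists l0; rewrite addn0; apply: exec_while_exit; rewrite /S; eval_upd.
set b := iteri i f a.
have s0'' j : d.+3 <= j -> S k i b j = 0.
  by move=> dj; rewrite /S; eval_upd; apply: s0; lia.
have [l3 E3] := EC O _ l0 s0''.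
have Eb : C O [seq S k i b v | v <- [:: d.+1, d.+2 & vs]] = iteri i.+1 f a.
  rewrite /= /S !(map_upd _ _ vsd); try lia.
  by rewrite /= /b /f; congr (C O [:: _, _ & _]); eval_upd.
rewrite Eb in E3.
have [l4 E4] := IH i.+1 l3.
exists l4; apply: (@exec_while_step _ _ _ _ _ (S k i.+1 (iteri i.+1 f a)) l3).
- by rewrite /S; eval_upd.
- apply: exec_seq.
    apply: (@exec_eq _ _ _ _ _ (S k i b)); first by apply: exec_dec; rewrite /S; eval_upd.
    by rewrite /S; solve_upd.
  apply: exec_seq; first exact: E3.
  apply: exec_seq; first exact: exec_clear.
  apply: exec_seq; first by apply: exec_transfer; apply/eqP; lia.
  apply: exec_eq; first exact: exec_inc.
  have ? : s d.+3 = 0 by apply: s0; lia.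
  by rewrite /S; solve_upd.
- by rewrite addnS -addSn.
Qed.

(** Entries are popped, and counted in [d], until [Pop] no longer raises the flag [d.+1]. *)
Lemma computable_size o A : computable A -> computable (fun O e => size (O o (A O e))).
Proof.
move=> HA vs d vsd; have [cA EA] := HA vs d vsd.
pose body := Seq (Dec d.+1) (Seq (Pop d.+2 d.+1) (Seq (clear d.+2) (Inc d))).
exists (Seq cA (Seq (AskList o d) (Seq (Inc d.+1) (Seq (While d.+1 body) (Dec d))))).
move=> O s l s0; set a := A O _; have [l1 E1] := EA O s l s0.
(* The pass that finds the list empty is counted as well, whence [(size r).+1] and the final
   [Dec d]. *)
have loop r k : exec O (While d.+1 body) (upd (upd s d k) d.+1 1) r
    (upd s d (k + (size r).+1)) [::].
  have s1 : s d.+1 = 0 by apply: s0; lia.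
  have s2 : s d.+2 = 0 by apply: s0; lia.
  elim: r k => [|x r IH] k; apply: exec_while_step.
  - by eval_upd.
  - apply: exec_seq; first by apply: exec_dec; eval_upd.
    apply: exec_seq; first exact: exec_pop_nil.
    by apply: exec_seq; [exact: exec_clear|exact: exec_inc].
  - apply: exec_eq; first by apply: exec_while_exit; eval_upd.
    by rewrite /=; solve_upd.
  - by eval_upd.
  - apply: exec_seq; first by apply: exec_dec; eval_upd.
    apply: exec_seq; first by apply: exec_pop; apply/eqP; lia.
    by apply: exec_seq; [exact: exec_clear|exact: exec_inc].
  - move: (IH k.+1); rewrite addSnnS; congr (exec _ _ _ _ _ _).
    by solve_upd.
exists [::]; apply: exec_seq; first exact: E1.
apply: exec_seq; first exact: exec_ask.
apply: exec_seq; first exact: exec_inc.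
have Ea : upd s d a d = a by eval_upd.
rewrite Ea; apply: exec_seq.
  apply: (@exec_eqs _ _ _ (upd (upd s d 0) d.+1 1)); last exact: loop.
  have ? : s d.+1 = 0 by apply: s0; lia.
  by solve_upd.
apply: exec_eq; first by apply: exec_dec; eval_upd.
by solve_upd.
Qed.

(** The entries before the wanted one are popped and discarded. Past the end [Pop] adds nothing,
    which gives 0, the default of [nth]. *)
Lemma computable_lookup o A I : computable A -> computable I ->
  computable (fun O e => nth 0 (O o (A O e)) (I O e)).
Proof.
move=> HA HI vs d vsd; have [cA EA] := HA vs d vsd.
have [cI EI] := HI vs d.+1 (all_ltnW (leqnSn d) vsd).
pose skip x := Seq (Pop x d.+3) (clear d.+3).
exists (Seq cA (Seq cI (Seq (AskList o d) (Seq
  (While d.+1 (Seq (Dec d.+1) (Seq (skip d.+2) (clear d.+2)))) (skip d))))).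
move=> O s l s0; set e := map s vs; set a := A O _; set i := I O _.
have [l1 E1] := EA O s l s0.
have s0' : forall i, d.+1 <= i -> upd s d a i = 0.
  by move=> j dj; eval_upd; apply: s0; lia.
have [l2 E2] := EI O _ l1 s0'.
rewrite (map_upd _ _ vsd) // -/e -/i in E2.
have s1 : s d.+1 = 0 by apply: s0; lia.
have s2 : s d.+2 = 0 by apply: s0; lia.
have s3 : s d.+3 = 0 by apply: s0; lia.
have s4 : s d = 0 by apply: s0; lia.
have pop x t r : x = d \/ x = d.+2 -> t x = 0 -> t d.+3 = 0 ->
    exec O (skip x) t r (upd t x (head 0 r)) (behead r).
  move=> xd x0 t3; have x3 : x <> d.+3 by lia.
  case: r => [|y r]; apply: exec_seq; [exact: exec_pop_nil| | |].
  - by apply: exec_eq; [exact: exec_clear|solve_upd].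
  - by apply: exec_pop; exact/eqP.
  - by apply: exec_eq; [exact: exec_clear|rewrite /=; solve_upd].
have loop k r : exec O (While d.+1 (Seq (Dec d.+1) (Seq (skip d.+2) (clear d.+2))))
    (upd s d.+1 k) r s (drop k r).
  elim: k r => [|k IH] r.
    rewrite drop0; apply: exec_eq; first by apply: exec_while_exit; eval_upd.
    by solve_upd.
  apply: (@exec_while_step _ _ _ _ _ (upd s d.+1 k) (behead r)).
  - by eval_upd.
  - apply: exec_seq; first by apply: exec_dec; eval_upd.
    apply: (@exec_seq _ _ _ _ _ (upd (upd s d.+1 k) d.+2 (head 0 r)) (behead r)).
      apply: (@exec_eqs _ _ _ (upd s d.+1 k)); first by solve_upd.
      by apply: pop; [right|eval_upd..].
    by apply: exec_eq; [exact: exec_clear|solve_upd].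
  - by rewrite -[k.+1]addn1 -drop_drop drop1 -[X in drop k X](drop1 r) drop1; exact: IH.
exists (behead (drop i (O o a))); apply: exec_seq; first exact: E1.
apply: exec_seq; first exact: E2.
apply: exec_seq; first exact: exec_ask.
have -> : upd (upd s d a) d.+1 i d = a by eval_upd.
apply: exec_seq.
  by apply: (@exec_eqs _ _ _ (upd s d.+1 i)); [solve_upd|exact: loop].
have -> : nth 0 (O o a) i = head 0 (drop i (O o a)).
  by rewrite -nth0 nth_drop addn0.
by apply: pop => //; left.
Qed.

Lemma computable_succ F : computable F -> computable (fun O e => (F O e).+1).
Proof.
move=> H vs d vsd; have [c E] := H vs d vsd.
exists (Seq c (Inc d)) => O s l s0; have [l1 E1] := E O s l s0.
exists l1; apply: exec_seq; first exact: E1.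
by apply: exec_eq; [exact: exec_inc|solve_upd].
Qed.

(** The input sits in register 0; computing with first free register 1, then 2, then 3 preserves the
    earlier results. *)
Lemma program_machine_computable F1 F2 F3 :
  computable F1 -> computable F2 -> computable F3 ->
  exists M, forall O n, computes M (fun o m => code_nats (O o m))
    (code_nats [:: n])
    (code_nats [:: F1 O [:: n]; F2 O [:: n]; F3 O [:: n]]).
Proof.
move=> H1 H2 H3.
have [c1 E1] := H1 [:: 0] 1 isT; have [c2 E2] := H2 [:: 0] 2 isT.
have [c3 E3] := H3 [:: 0] 3 isT.
pose c := Seq c1 (Seq c2 c3).
exists (program_machine (maxn 3 (command_bound c)) c) => O n.
set s0 := upd (fun=> 0) 0 n.
have [|l1 X1] := E1 O s0 [::]; first by move=> i; rewrite /s0; eval_upd.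
set s1 := upd _ 1 _ in X1.
have [|l2 X2] := E2 O s1 l1; first by move=> i; rewrite /s1 /s0; eval_upd.
set s2 := upd _ 2 _ in X2.
have [|l3 X3] := E3 O s2 l2; first by move=> i; rewrite /s2 /s1 /s0; eval_upd.
have := program_computes (leq_maxr 3 (command_bound c)) (leq_maxl 3 _)
  (exec_seq X1 (exec_seq X2 X3)).
by rewrite /upd.
Qed.

                      

(** * Arithmetic of computable functions *)

Section Arithmetic.
Implicit Types (A B N : list_oracle -> seq nat -> nat).

Lemma eq_computable A B : (forall O e, A O e = B O e) -> computable A -> computable B.
Proof.
move=> AB HA vs d vsd; have [c E] := HA vs d vsd.
by exists c => O s l /(E O s l); rewrite AB.
Qed.

Lemma computable_add A B :
  computable A -> computable B -> computable (fun O e => A O e + B O e).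
Proof.
move=> HA HB; apply: eq_computable (computable_iteri HB HA
  (computable_succ computable_head)) => O e /=.
by elim: (B O e) => [|n IH] /=; rewrite ?addn0 // addnS -IH.
Qed.

Lemma computable_pred A : computable A -> computable (fun O e => (A O e).-1).
Proof.
move=> HA; apply: eq_computable (computable_iteri HA (computable_const 0)
  (computable_behead computable_head)) => O e /=.
by case: (A O e).
Qed.

Lemma computable_sub A B :
  computable A -> computable B -> computable (fun O e => A O e - B O e).
Proof.
move=> HA HB; apply: eq_computable (computable_iteri HB HA
  (computable_pred computable_head)) => O e /=.
by elim: (B O e) => [|n IH] /=; rewrite ?subn0 // subnS -IH.
Qed.

(** The summation index reaches [F] as a new first variable of the environment. *)
Lemma computable_sum N (F : list_oracle -> nat -> seq nat -> nat) :
  computable N -> computable (fun O e => F O (head 0 e) (behead e)) ->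
  computable (fun O e => \sum_(0 <= i < N O e) F O i e).
Proof.
move=> HN HF; apply: eq_computable (computable_iteri HN (computable_const 0)
  (computable_add computable_head (computable_behead HF))) => O e /=.
elim: (N O e) => [|n IH] /=; first by rewrite big_geq.
by rewrite big_nat_recr //= IH.
Qed.

Lemma computable_mul A B :
  computable A -> computable B -> computable (fun O e => A O e * B O e).
Proof.
move=> HA HB; apply: eq_computable
  (@computable_sum _ (fun O _ e => B O e) HA (computable_behead HB)) => O e.
by rewrite sum_nat_const_nat subn0.
Qed.

Lemma computable_prod N (F : list_oracle -> nat -> seq nat -> nat) :
  computable N -> computable (fun O e => F O (head 0 e) (behead e)) ->
  computable (fun O e => \prod_(0 <= i < N O e) F O i e).
Proof.
move=> HN HF; apply: eq_computable (computable_iteri HN (computable_const 1)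
  (computable_mul computable_head (computable_behead HF))) => O e /=.
elim: (N O e) => [|n IH] /=; first by rewrite big_geq.
by rewrite big_nat_recr //= IH.
Qed.

Lemma computable_exp A B :
  computable A -> computable B -> computable (fun O e => A O e ^ B O e).
Proof.
move=> HA HB; apply: eq_computable
  (@computable_prod _ (fun O _ e => A O e) HB (computable_behead HA)) => O e.
by rewrite prod_nat_const_nat subn0.
Qed.

Lemma computable_leq A B : computable A -> computable B ->
  computable (fun O e => nat_of_bool (A O e <= B O e)).
Proof.
move=> HA HB; apply: eq_computable
  (computable_sub (computable_const 1) (computable_sub HA HB)) => O e.
rewrite /leq; lia.
Qed.

Lemma computable_eq A B : computable A -> computable B ->
  computable (fun O e => nat_of_bool (A O e == B O e)).
Proof.
move=> HA HB; apply: eq_computable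
  (computable_mul (computable_leq HA HB) (computable_leq HB HA)) => O e.
by rewrite eqn_leq mulnb.
Qed.

Lemma computable_neg (P : list_oracle -> seq nat -> bool) :
  computable (fun O e => nat_of_bool (P O e)) ->
  computable (fun O e => nat_of_bool (~~ P O e)).
Proof.
move=> H; apply: eq_computable (computable_sub (computable_const 1) H) => O e.
by case: (P O e).
Qed.

Lemma computable_if (P : list_oracle -> seq nat -> bool) A B :
  computable (fun O e => nat_of_bool (P O e)) -> computable A -> computable B ->
  computable (fun O e => if P O e then A O e else B O e).
Proof.
move=> HP HA HB; apply: eq_computable (computable_add (computable_mul HP HA)
  (computable_mul (computable_neg HP) HB)) => O e.
by case: (P O e); rewrite ?mul0n ?mul1n ?addn0.
Qed.

Lemma sum_ltn m k : \sum_(0 <= i < m) (i < k) = minn m k.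
Proof.
elim: m => [|m IH]; first by rewrite big_geq // min0n.
by rewrite big_nat_recr //= IH; lia.
Qed.

(** The quotient a/b counts the i < a with (i+1) b <= a; the factor testing 1 <= b yields 0 when b =
    0, as in [divn]. *)
Lemma computable_div A B :
  computable A -> computable B -> computable (fun O e => A O e %/ B O e).
Proof.
move=> HA HB; apply: eq_computable (computable_mul
  (computable_leq (computable_const 1) HB)
  (@computable_sum _ (fun O i e => nat_of_bool (i.+1 * B O e <= A O e)) HA
    (computable_leq (computable_mul (computable_succ computable_head)
      (computable_behead HB)) (computable_behead HA)))) => O e.
case: (posnP (B O e)) => [->|B0]; first by rewrite divn0.
rewrite mul1n -[RHS](minn_idPr (leq_div (A O e) (B O e))) -sum_ltn.
by apply: eq_bigr => i _; rewrite -leq_divRL.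
Qed.

End Arithmetic.

Ltac computability :=
  cbv beta zeta; repeat (first
  [ assumption
  | match goal with
    | H : computable ?J |- computable (fun O e => ?J O (behead e)) =>
        exact: (computable_behead H)
    | H : computable ?J |- computable (fun O e => ?J O (behead (behead e))) =>
        exact: (computable_behead (computable_behead H))
    | H : forall J, computable J -> _ |- _ => apply H
    | H : forall J E, computable J -> _ |- _ => apply H
    | H : forall J E P, computable J -> _ |- _ => apply H
    | |- computable (fun _ _ => ?n) => exact: computable_const
    | |- computable (fun O e => head 0 e) => exact: computable_head
    | |- computable (fun O e => head 0 (behead e)) =>
        exact: (computable_behead computable_head)
    | |- computable (fun O e => @?A O e + @?B O e) => apply (@computable_add A B)
    | |- computable (fun O e => @?A O e - @?B O e) => apply (@computable_sub A B)
    | |- computable (fun O e => @?A O e * @?B O e) => apply (@computable_mul A B)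
    | |- computable (fun O e => @?A O e ^ @?B O e) => apply (@computable_exp A B)
    | |- computable (fun O e => @?A O e %/ @?B O e) => apply (@computable_div A B)
    | |- computable (fun O e => S (@?A O e)) => apply (@computable_succ A)
    | |- computable (fun O e => predn (@?A O e)) => apply (@computable_pred A)
    | |- computable (fun O e => nat_of_bool (@?A O e == @?B O e)) =>
        apply (@computable_eq A B)
    | |- computable (fun O e => nat_of_bool (@?A O e <= @?B O e)) =>
        apply (@computable_leq A B)
    | |- computable (fun O e => nat_of_bool (~~ @?A O e)) =>
        apply (@computable_neg A)
    | |- computable (fun O e => \sum_(0 <= i < @?N O e) @?F O e i) =>
        apply (@computable_sum N (fun O i e => F O e i))
    | |- computable (fun O e => \prod_(0 <= i < @?N O e) @?F O e i) =>
        apply (@computable_prod N (fun O i e => F O e i))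
    | |- computable (fun O e => nth 0 (O ?o (@?A O e)) (@?B O e)) =>
        apply (@computable_lookup o A B)
    | |- computable (fun O e => size (O ?o (@?A O e))) =>
        apply (@computable_size o A)
    end
  | apply computable_if ]; cbv beta).

(** * The algorithm, in natural-number arithmetic *)

Section Algorithm.
Variable letters : nat.
Variable O : list_oracle.

                                                                         
                                                                           
                                                                               
                                                                          
                                                                                                               
Definition pot_radius j := nth 0 (O Potential j) 0.
(** With radius k, a word of length L = 2 depth + 1 contains L - 2k = 2(j+1)(k+1) + 1 full windows
    of length 2k+1 ([windows]), and L >= 2k(j+1): the two ends are a share of at most 1/(j+1). *)
Definition depth j := pot_radius j + j.+1 * (pot_radius j).+1.
Definition word_length j := (2 * depth j).+1.
Definition windows j := (2 * (j.+1 * (pot_radius j).+1)).+1.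
(** The sum of all numbers in the code of chi(0) dominates every numerator, and 1 is added for the
    error of chi(0); the result bounds |phi| ([norm_le_bound]). *)
Definition bound :=
  (\sum_(0 <= i < size (O Potential 0)) nth 0 (O Potential 0) i).+1.
(** The length of a coded table entry: 2k+1 letters, then sign, numerator and denominator. *)
Definition block j := 2 * pot_radius j + 4.
Definition entries j := (size (O Potential j)).-1 %/ block j.
Definition words j := size (O Language (depth j)) %/ word_length j.

Definition matches j e p : bool :=
  \sum_(0 <= t < (2 * pot_radius j).+1)
    (nth 0 (O Potential j) (e * block j + t).+1
       != nth 0 (O Language (depth j)) (p + t)) == 0.

(** An integer estimate of 2^j (phi + B) from above, too large by at most 4: rounding and the oracle
    cost at most 1 each in either direction, and the added 2 makes the total error nonnegative. *)
Definition entry_value j e : nat :=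
  let b := e * block j + 2 * pot_radius j + 2 in
  let v := (nth 0 (O Potential j) b.+1 * 2 ^ j) %/ nth 0 (O Potential j) b.+2 in
  if nth 0 (O Potential j) b == 0 then bound * 2 ^ j + 2 + v
  else bound * 2 ^ j + 2 - v.

Definition window_value j p :=
  \sum_(0 <= e < entries j) matches j e p * entry_value j e.

(** An estimate of 2^j (S_L phi + L B) from above. The 2k positions near the ends have no full
    window inside the word; each is charged 2B, an upper bound of phi + B. *)
Definition weight j u :=
  4 * pot_radius j * bound * 2 ^ j +
  \sum_(0 <= i < windows j) window_value j (u * word_length j + i).

(** The oracle may list a word several times; only its first occurrence is to be counted. *)
Definition fresh j u : bool :=
  \sum_(0 <= v < u)
    (\sum_(0 <= t < word_length j)
       (nth 0 (O Language (depth j)) (v * word_length j + t)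
          != nth 0 (O Language (depth j)) (u * word_length j + t)) == 0) == 0.

(** The exponent M exceeds (L c)^2, so that (1 + y/M)^(-M) is within a factor e of e^(-y) for 0 <= y
    <= L c. *)
Definition power j c := ((word_length j * c) ^ 2).+1.
Definition base j c := power j c * 2 ^ j.
Definition slack j c u := word_length j * c - weight j u.

(** With denominators cleared, this says that the sum of (1 + y/M)^(-M) over the distinct words is
    below 1, where y = (L c - weight)/2^j ([passesE]). A negative y is truncated to 0; its term is
    then 1 and the test fails. *)
Definition passes j c : bool :=
  \sum_(0 <= u < words j) fresh j u *
    \prod_(0 <= v < words j)
      (if v == u then base j c else base j c + slack j c v) ^ power j c
  < \prod_(0 <= v < words j) (base j c + slack j c v) ^ power j c.

(** Counting failures replaces a search for the least passing c and requires no monotonicity of the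
    test. The range is long enough because p + B <= 2B + [letters] when [letters] is the size of the
    alphabet. *)
Definition level j :=
  \sum_(0 <= c < 2 ^ j * (2 * bound + letters)) ~~ passes j c.

(** best(n)/2^n is the minimum of level(i)/2^i over i <= n; the factor 2 accounts for the change of
    denominator. *)
Definition best n := iteri n (fun i b => minn (2 * b) (level i.+1)) (level 0).

(** The output is best/2^n + 2^(-n-1) - B. The extra half unit makes the numerator odd over a power
    of 2, so no gcd has to be computed. *)
Definition out_num n := (2 * best n).+1.
Definition out_den n := 2 ^ n.+1.
Definition out_shift n := bound * out_den n.

End Algorithm.

(** * The algorithm is computable by a machine *)

Section AlgorithmComputable.
Variable letters : nat.
Implicit Types J : list_oracle -> seq nat -> nat.

Let pot_radius_computable J :
  computable J -> computable (fun O e => pot_radius O (J O e)).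
Proof. by move=> HJ; rewrite /pot_radius; computability. Qed.

Let depth_computable J : computable J -> computable (fun O e => depth O (J O e)).
Proof. by move=> HJ; rewrite /depth; computability. Qed.

Let word_length_computable J :
  computable J -> computable (fun O e => word_length O (J O e)).
Proof. by move=> HJ; rewrite /word_length; computability. Qed.

Let windows_computable J :
  computable J -> computable (fun O e => windows O (J O e)).
Proof. by move=> HJ; rewrite /windows; computability. Qed.

Let bound_computable : computable (fun O e => bound O).
Proof. by rewrite /bound; computability. Qed.

Let block_computable J : computable J -> computable (fun O e => block O (J O e)).
Proof. by move=> HJ; rewrite /block; computability. Qed.

Let entries_computable J :
  computable J -> computable (fun O e => entries O (J O e)).
Proof. by move=> HJ; rewrite /entries; computability. Qed.

Let words_computable J :
  computable J -> computable (fun O e => words O (J O e)).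
Proof. by move=> HJ; rewrite /words; computability. Qed.

Let matches_computable J E P : computable J -> computable E -> computable P ->
  computable (fun O e => nat_of_bool (matches O (J O e) (E O e) (P O e))).
Proof. by move=> HJ HE HP; rewrite /matches; computability. Qed.

Let entry_value_computable J E : computable J -> computable E ->
  computable (fun O e => entry_value O (J O e) (E O e)).
Proof. by move=> HJ HE; rewrite /entry_value; computability. Qed.

Let window_value_computable J P : computable J -> computable P ->
  computable (fun O e => window_value O (J O e) (P O e)).
Proof. by move=> HJ HP; rewrite /window_value; computability. Qed.

Let weight_computable J U : computable J -> computable U ->
  computable (fun O e => weight O (J O e) (U O e)).
Proof. by move=> HJ HU; rewrite /weight; computability. Qed.

Let fresh_computable J U : computable J -> computable U ->
  computable (fun O e => nat_of_bool (fresh O (J O e) (U O e))).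
Proof. by move=> HJ HU; rewrite /fresh; computability. Qed.

Let power_computable J C : computable J -> computable C ->
  computable (fun O e => power O (J O e) (C O e)).
Proof. by move=> HJ HC; rewrite /power; computability. Qed.

Let base_computable J C : computable J -> computable C ->
  computable (fun O e => base O (J O e) (C O e)).
Proof. by move=> HJ HC; rewrite /base; computability. Qed.

Let slack_computable J C U : computable J -> computable C -> computable U ->
  computable (fun O e => slack O (J O e) (C O e) (U O e)).
Proof. by move=> HJ HC HU; rewrite /slack; computability. Qed.

Let passes_computable J C : computable J -> computable C ->
  computable (fun O e => nat_of_bool (passes O (J O e) (C O e))).
Proof. by move=> HJ HC; rewrite /passes; computability. Qed.

Let level_computable J :
  computable J -> computable (fun O e => level letters O (J O e)).
Proof. by move=> HJ; rewrite /level; computability. Qed.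

Let best_computable J :
  computable J -> computable (fun O e => best letters O (J O e)).
Proof.
move=> HJ.
have H0 : computable (fun O e => level letters O 0).
  exact: (level_computable (computable_const 0)).
have HC : computable (fun O e =>
    minn (2 * head 0 e) (level letters O (head 0 (behead e)).+1)).
  apply: (@eq_computable (fun O e => 2 * head 0 e -
    (2 * head 0 e - level letters O (head 0 (behead e)).+1))).
    by move=> O e; rewrite minnE.
  by computability.
exact: (computable_iteri HJ H0 HC).
Qed.

Lemma machine_algorithm : exists M, forall O n,
  computes M (fun o m => code_nats (O o m)) (code_nats [:: n])
    (code_nats [:: nat_of_bool (out_num letters O n < out_shift O n);
      (out_num letters O n - out_shift O n) + (out_shift O n - out_num letters O n);
      out_den n]).
Proof.
have [|||M HM] := @program_machine_computable
  (fun O e => nat_of_bool (out_num letters O (head 0 e) < out_shift O (head 0 e)))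
  (fun O e => (out_num letters O (head 0 e) - out_shift O (head 0 e)) +
     (out_shift O (head 0 e) - out_num letters O (head 0 e)))
  (fun O e => out_den (head 0 e)).
- by rewrite /out_num /out_shift /out_den; computability.
- by rewrite /out_num /out_shift /out_den; computability.
- by rewrite /out_den; computability.
by exists M.
Qed.

End AlgorithmComputable.

Lemma machine_opposite : exists M, forall O n,
  computes M (fun o m => code_nats (O o m)) (code_nats [:: n])
    (code_nats [:: nat_of_bool (0 < n); n; 1]).
Proof.
have [|||M HM] := @program_machine_computable
  (fun O e => nat_of_bool (0 < head 0 e)) (fun O e => head 0 e) (fun O e => 1).
- by computability.
- by computability.
- by computability.
by exists M.
Qed.

                                         

Import Order.TTheory GRing.Theory Num.Theory.
Import numFieldNormedType.Exports.

Local Open Scope classical_set_scope.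
Local Open Scope ring_scope.

(** * Shifts, subwords and compactness *)

Section Shifts.
Variable A : finType.
Implicit Types (x : fullshift A) (X : set (fullshift A)).

Definition shift_by (i : int) x : fullshift A := fun t => x (t + i).

Lemma iter_shift_map k x : iter k (@shift_map A) x = shift_by k%:Z x.
Proof.
elim: k => [|k IH]; rewrite funeqE => t; first by rewrite /shift_by addr0.
by rewrite iterS IH /shift_map /shift_by -addrA -intS.
Qed.

(** Backwards, the shift maps [X] onto itself and is injective, so the preimage of [x] in [X] is [x]
    shifted back. *)
Lemma shift_by_in X i x : subshift X -> X x -> X (shift_by i x).
Proof.
move=> [_ fX]; have fwd (n : nat) y : X y -> X (shift_by n%:Z y).
  rewrite -iter_shift_map => Xy; elim: n => //= n Xn.
  by rewrite -fX; exists (iter n (@shift_map A) y).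
case: (intP i) => [|n|n]; [exact: (fwd 0%N)|exact: fwd|].
move: n.+1 => {i}n; elim: n x => [|n IH] x Xx; first by rewrite oppr0; exact: (fwd 0%N).
have [y Xy <-] : (@shift_map A @` X) x by rewrite fX.
rewrite (_ : shift_by _ _ = shift_by (- n%:Z) y); first exact: IH.
rewrite funeqE => t; rewrite /shift_by /shift_map; congr y; lia.
Qed.

Lemma size_subword x i n : size (subword x i n) = n.
Proof. by rewrite size_mkseq. Qed.

Lemma nth_subword a x i n k : (k < n)%N -> nth a (subword x i n) k = x (i + k%:Z).
Proof. by move=> kn; rewrite nth_mkseq. Qed.

Lemma subword_shift_by x i j n :
  subword (shift_by i x) j n = subword x (j + i) n.
Proof. by apply: eq_mkseq => k; rewrite /shift_by addrAC. Qed.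

Lemma subword_add x i m n :
  subword x i (m + n) = subword x i m ++ subword x (i + m%:Z) n.
Proof.
rewrite /subword /mkseq iotaD map_cat add0n; congr (_ ++ _).
rewrite -{1}[m]addn0 iotaDl -map_comp; apply: eq_map => k /=.
by rewrite PoszD addrA.
Qed.

Lemma admissible_subword X x i n : X x -> admissible X (subword x i n).
Proof. by exists x => //; exists i; rewrite size_subword. Qed.

Lemma admissible_cylinder X w :
  subshift X -> admissible X w -> cylinder X w !=set0.
Proof.
move=> sX [x Xx [i E]]; exists (shift_by i x); split; first exact: shift_by_in.
by rewrite subword_shift_by add0r.
Qed.

Lemma fullshift_compact : compact [set: fullshift A].
Proof.
rewrite (_ : setT = [set x : fullshift A | forall i, [set: discrete_topology A] (x i)]).
  apply: (@tychonoff int (fun=> discrete_topology A) (fun=> setT)) => i.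
  by apply: finite_compact; exact: finite_finset.
by rewrite eqEsubset.
Qed.

(** By compactness. Boundedness gives meaning to the suprema in the partition sums and in the oracle
    condition, since [sup] of an unbounded set is a default value. *)
Lemma subshift_bounded (R : realType) X (phi : fullshift A -> R) :
  closed X -> {within X, continuous phi} ->
  exists B, forall x, X x -> `|phi x| <= B.
Proof.
move=> cX cphi.
have cptX : compact X := subclosed_compact cX fullshift_compact (@subsetT _ X).
have [B [_ HB]] := compact_bounded (continuous_compact cphi cptX).
exists (B + 1) => x Xx; apply: (HB (B + 1)); first by rewrite ltrDl.
by exists x.
Qed.

End Shifts.

(** * Fekete's lemma *)

Section Fekete.
Variables (R : realType) (s : nat -> R).
Hypothesis subadd : forall m n, s (m + n)%N <= s m + s n.

Lemma subadditive_mul q m : s 0 = 0 -> s (q * m)%N <= q%:R * s m.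
Proof.
move=> s0; elim: q => [|q IH]; first by rewrite mul0n s0 mul0r.
by rewrite mulSn (le_trans (subadd _ _)) // mulrS mulrDl mul1r lerD2l.
Qed.

(** The limit is the infimum of s(n)/n, finite by the linear lower bound. If s(m)/m is close to it
    and n = q m + r, then s(n) <= q s(m) + s(r), and what r < m contributes is bounded. *)
Lemma fekete (C : R) : s 0 = 0 -> (forall n, - C * n%:R <= s n) ->
  exists p : R, (forall n, (0 < n)%N -> p * n%:R <= s n) /\
    s n / n%:R @[n --> \oo] --> p.
Proof.
move=> s0 sC.
pose E := [set s n.+1 / n.+1%:R | n in [set: nat]].
have lbE : lbound E (- C).
  by move=> _ [n _ <-]; rewrite ler_pdivlMr // ltr0n.
have infE : has_inf E by split; [exists (s 1 / 1); exists 0%N|exists (- C)].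
have pE n : (0 < n)%N -> inf E * n%:R <= s n.
  case: n => // n _; rewrite -ler_pdivlMr ?ltr0n //.
  by apply: ge_inf; [case: infE|exists n].
exists (inf E); split => //.
apply/cvgrPdist_le => e e0.
have [_ [m _ <-]] := inf_adherent (divr_gt0 e0 (ltr0n R 2)) infE.
set M := s m.+1 / m.+1%:R => HM.
(* The first summand bounds s(r), as s(r) <= r s(1); the second bounds the difference between M n
   and q s(m+1). *)
pose K := `|s 1| * m.+1%:R + `|M| * m.+1%:R.
near=> n.
have n0 : (0 < n)%N by near: n; exact: nbhs_infty_gt.
have n0R : (0 : R) < n%:R by rewrite ltr0n.
rewrite ler_distlC; apply/andP; split.
  rewrite ler_pdivlMr // (le_trans _ (pE _ n0)) // ler_wpM2r ?ler0n //.
  by rewrite gerBl ltW.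
rewrite ler_pdivrMr //.
have -> : s n = s (n %/ m.+1 * m.+1 + n %% m.+1)%N by rewrite -divn_eq.
apply: (le_trans (subadd _ _)).
have H1 := subadditive_mul (n %/ m.+1) m.+1 s0.
have H2 : s (n %% m.+1)%N <= `|s 1| * m.+1%:R.
  rewrite -[(n %% _)%N]muln1 (le_trans (subadditive_mul _ _ s0)) //.
  rewrite mulrC; apply: (le_trans (ler_norm _)); rewrite normrM.
  by rewrite ler_wpM2l // ger0_norm ?ler_nat ?ler0n // ltnW // ltn_mod.
have H3 : (n %/ m.+1)%:R * s m.+1 <= M * n%:R + `|M| * m.+1%:R.
  have -> : s m.+1 = M * m.+1%:R by rewrite divfK // pnatr_eq0.
  have Em : n%:R = (n %/ m.+1)%:R * m.+1%:R + (n %% m.+1)%:R :> R.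
    by rewrite -natrM -natrD -divn_eq.
  have Hr : `|M * (n %% m.+1)%:R| <= `|M| * m.+1%:R.
    by rewrite normrM ler_wpM2l // ger0_norm ?ler_nat ?ler0n // ltnW // ltn_mod.
  move: Hr; rewrite ler_norml => /andP[Hr _].
  rewrite Em mulrDr; lra.
have H4 : K <= e / 2 * n%:R.
  rewrite -ler_pdivrMl ?divr_gt0 //; near: n; exact: nbhs_infty_ger.
have H5 : M * n%:R <= (inf E + e / 2) * n%:R by rewrite ler_wpM2r ?ler0n // ltW.
rewrite /K in H4; lra.
Unshelve. all: by end_near.
Qed.

End Fekete.

                                    

(** * The pressure as an infimum over word lengths *)

Section Pressure.
Variables (R : realType) (A : finType) (X : set (fullshift A)).
Variables (phi : fullshift A -> R) (B : R).
Hypothesis sX : subshift X.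
Hypothesis X0 : X !=set0.
Hypothesis phiB : forall x, X x -> `|phi x| <= B.

Notation S := (birkhoff_sum phi).
Notation Z := (partition_sum X phi).

Lemma birkhoff_sumE n x : S n x = \sum_(k < n) phi (shift_by k%:Z x).
Proof. by apply: eq_bigr => k _; rewrite iter_shift_map. Qed.

Lemma shift_byD (i j : int) (x : fullshift A) :
  shift_by i (shift_by j x) = shift_by (i + j) x.
Proof. by rewrite funeqE => t; rewrite /shift_by addrA. Qed.

Lemma birkhoff_sumD m n x : S (m + n)%N x = S m x + S n (shift_by m%:Z x).
Proof.
rewrite !birkhoff_sumE big_split_ord /=; congr (_ + _).
by apply: eq_bigr => k _; rewrite shift_byD addrC -PoszD.
Qed.

Lemma norm_birkhoff_sum n x : X x -> `|S n x| <= B * n%:R.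
Proof.
move=> Xx; rewrite birkhoff_sumE (le_trans (ler_norm_sum _ _ _)) //.
have -> : B * n%:R = \sum_(k < n) B by rewrite sumr_const card_ord mulr_natr.
by apply: ler_sum => k _; apply: phiB; exact: shift_by_in.
Qed.

Lemma le_sup_cylinder n w x :
  cylinder X w x -> S n x <= sup (S n @` cylinder X w).
Proof.
move=> wx; apply: ub_le_sup; last by exists x.
exists (B * n%:R) => _ [y [Xy _] <-].
by rewrite (le_trans (ler_norm _)) // norm_birkhoff_sum.
Qed.

Lemma sup_cylinder_le n w M : admissible X w ->
  (forall x, cylinder X w x -> S n x <= M) -> sup (S n @` cylinder X w) <= M.
Proof.
move=> /(admissible_cylinder sX)[y wy] H; apply: ge_sup.
  by exists (S n y); exists y.
by move=> _ [x wx <-]; exact: H.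
Qed.

Definition subword_tuple (x : fullshift A) (i : int) n : n.-tuple A :=
  tcast (size_subword x i n) (in_tuple (subword x i n)).

Lemma val_subword_tuple x i n : subword_tuple x i n = subword x i n :> seq A.
Proof. by rewrite val_tcast. Qed.

Lemma cylinder_subword x n : X x -> cylinder X (subword x 0 n) x.
Proof. by move=> Xx; split=> //; rewrite size_subword. Qed.

Lemma partition_sum_ge n : expR (- B * n%:R) <= Z n.
Proof.
have [x Xx] := X0; rewrite /partition_sum.
rewrite (bigD1 (subword_tuple x 0 n)) /=; last first.
  by apply/asboolP; rewrite val_subword_tuple; exact: admissible_subword.
apply: (@le_trans _ _ (expR (sup (S n @` cylinder X (subword_tuple x 0 n))))).
  rewrite ler_expR val_subword_tuple.
  apply: (le_trans _ (le_sup_cylinder n (cylinder_subword n Xx))).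
  by have := norm_birkhoff_sum n Xx; rewrite ler_norml mulNr => /andP[].
by rewrite lerDl sumr_ge0 // => w _; exact: expR_ge0.
Qed.

Lemma partition_sum_gt0 n : 0 < Z n.
Proof. exact: lt_le_trans (expR_gt0 _) (partition_sum_ge n). Qed.

(** Concatenation identifies pairs of words with words of length m+n. If u v is admissible, a point
    of its cylinder lies in that of u and its m-th shift in that of v; the remaining pairs only
    enlarge the right-hand side. *)
Lemma partition_sum_add m n : Z (m + n)%N <= Z m * Z n.
Proof.
rewrite /partition_sum big_distrlr /= pair_big /=.
have bij_cat : bijective (fun p : m.-tuple A * n.-tuple A => cat_tuple p.1 p.2).
  apply: inj_card_bij; last by rewrite card_prod !card_tuple expnD.
  move=> [u v] [u' v'] /(congr1 val) /= /eqP.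
  by rewrite eqseq_cat ?size_tuple // => /andP[/eqP/val_inj -> /eqP/val_inj ->].
rewrite (reindex _ (onW_bij _ bij_cat)) /= big_mkcond [leRHS]big_mkcond /=.
apply: ler_sum => -[u v] _ /=; case: asboolP => [auv|_]; last first.
  by case: ifP => // _; rewrite mulr_ge0 // expR_ge0.
have cut x : cylinder X (u ++ v) x ->
    cylinder X u x /\ cylinder X v (shift_by m%:Z x).
  move=> [Xx]; rewrite size_cat subword_add !size_tuple => /eqP.
  rewrite eqseq_cat ?size_tuple ?size_subword // => /andP[/eqP ux /eqP vx].
  split; split; rewrite ?size_tuple //; first exact: shift_by_in.
  by rewrite subword_shift_by add0r -vx add0r.
have [x0 /cut[ux0 vx0]] := admissible_cylinder sX auv.
have adm w y : cylinder X w y -> admissible X w.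
  by move=> [Xy <-]; exact: admissible_subword.
rewrite (asboolT (adm _ _ ux0)) (asboolT (adm _ _ vx0)) /= -expRD ler_expR.
apply: sup_cylinder_le => // x /cut[ux vx].
by rewrite birkhoff_sumD lerD // le_sup_cylinder.
Qed.

Lemma partition_sum0 : Z 0 = 1.
Proof.
rewrite /partition_sum (bigD1 [tuple]) /=; last first.
  by apply/asboolP; have [x Xx] := X0; exact: (admissible_subword 0 0 Xx).
rewrite big1 ?addr0 => [|w /andP[_]]; last by rewrite [w]tuple0.
rewrite (_ : _ @` _ = [set 0]) ?sup1 ?expR0 // eqEsubset; split => [_ [x _ <-]|_ ->].
  by rewrite /= /birkhoff_sum big_ord0.
by have [x Xx] := X0; exists x; [split|rewrite /birkhoff_sum big_ord0].
Qed.

Lemma partition_sum1 : Z 1 <= #|A|%:R * expR B.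
Proof.
rewrite /partition_sum big_mkcond /=.
apply: (@le_trans _ _ (\sum_(w : 1.-tuple A) expR B)); last first.
  by rewrite sumr_const card_tuple expn1 mulr_natl.
apply: ler_sum => w _; case: asboolP => [aw|_]; last exact: expR_ge0.
rewrite ler_expR; apply: sup_cylinder_le => // x [Xx _].
by rewrite (le_trans (ler_norm _)) // (le_trans (norm_birkhoff_sum _ Xx)) // mulr1.
Qed.

(** Fekete's lemma for ln Z(n). The inequality at every n > 0 is what turns each finite computation
    into an upper bound of p. *)
Lemma pressure_lim : exists p, [/\ pressure X phi = p%:E,
  forall n, (0 < n)%N -> p * n%:R <= ln (Z n)
  & ln (Z n) / n%:R @[n --> \oo] --> p].
Proof.
have subadd m n : ln (Z (m + n)%N) <= ln (Z m) + ln (Z n).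
  rewrite -lnM ?posrE ?partition_sum_gt0 // ler_ln ?posrE ?mulr_gt0 ?partition_sum_gt0 //.
  exact: partition_sum_add.
have [||p [pZ cp]] := @fekete R (fun n => ln (Z n)) subadd B.
- by rewrite partition_sum0 ln1.
- by move=> n; rewrite -ler_expR lnK ?posrE ?partition_sum_gt0 // partition_sum_ge.
exists p; split => //; apply: cvg_lim => //.
rewrite (_ : (fun n => _) = (fun n => (ln (Z n) / n%:R)%:E)).
  by apply: cvg_EFin => //; exact: nearW.
rewrite funeqE => n; rewrite lne_EFin ?partition_sum_gt0 // -EFinM mulrC //.
Qed.

End Pressure.

                                           

(** * Counting failures, and bounds for the exponential *)

Section Counting.
Variables (R : realType) (P : nat -> bool).

Lemma count_ge (x : R) m : x <= m%:R ->
  (forall c, c%:R < x -> ~~ P c) -> x <= (\sum_(0 <= c < m) ~~ P c)%:R.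
Proof.
(* Strengthened for the induction: either the count has reached [x], or all of the first [m] numbers
   have failed. *)
move=> xm HP; suff : x <= (\sum_(0 <= c < m) ~~ P c)%:R \/
    (m <= \sum_(0 <= c < m) ~~ P c)%N.
  by case=> //; rewrite -(ler_nat R); exact: le_trans.
elim: m {xm} => [|m IH]; first by right.
rewrite big_nat_recr //= natrD; case: (lerP x (\sum_(0 <= c < m) ~~ P c)%:R) => [xl|lx].
  by left; rewrite (le_trans xl) // lerDl.
case: IH => [|ml]; first by rewrite leNgt lx.
by right; rewrite HP ?addn1 // (le_lt_trans _ lx) // ler_nat.
Qed.

(** All failures are among the integers from 0 to the integer part of [y]. *)
Lemma count_le (y : R) m : 0 <= y -> (forall c, ~~ P c -> c%:R <= y) ->
  (\sum_(0 <= c < m) ~~ P c)%:R <= y + 1.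
Proof.
move=> y0 HP; elim: m => [|m IH]; first by rewrite big_geq // addr_ge0.
rewrite big_nat_recr //= natrD; case Pm : (P m); first by rewrite addr0.
rewrite lerD2r (le_trans _ (HP _ (negbT Pm))) // ler_nat.
rewrite -[leqRHS](subn0 m) -[leqRHS]muln1 -sum_nat_const_nat.
by apply: leq_sum => i _; case: (P i).
Qed.

End Counting.

Section Terms.
Variable R : realType.

(** From 1 + t <= e^t at t = y/M. *)
Lemma expRN_le_pow (y : R) M : 0 <= y -> (0 < M)%N ->
  expR (- y) <= (1 + y / M%:R) ^- M.
Proof.
move=> y0 M0; have M0' : (0 : R) < M%:R by rewrite ltr0n.
have s0 : 0 <= y / M%:R by rewrite divr_ge0 // ltW.
rewrite expRN lef_pV2 ?posrE ?expR_gt0 ?exprn_gt0 //; last by lra.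
have -> : expR y = expR (y / M%:R) ^+ M.
  by rewrite -expRM_natl; congr expR; field; rewrite gt_eqF.
by rewrite lerXn2r ?nnegrE ?expR_ge0 ?expR_ge1Dx //; lra.
Qed.

(** 1/(1 + y/M) = 1 - y/(M + y) <= exp(-y/(M + y)), and M y/(M + y) = y - y^2/(M + y) >= y - 1 once
    y^2 <= M. *)
Lemma pow_le_expRN (y : R) M : 0 <= y -> (0 < M)%N -> y ^+ 2 <= M%:R ->
  (1 + y / M%:R) ^- M <= expR (1 - y).
Proof.
move=> y0 M0 yM; have M0' : (0 : R) < M%:R by rewrite ltr0n.
have s0 : 0 <= y / M%:R by rewrite divr_ge0 // ltW.
have My : 0 < M%:R + y by lra.
have -> : (1 + y / M%:R) ^- M = (1 + - (y / (M%:R + y))) ^+ M.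
  by rewrite -exprVn; congr (_ ^+ _); field; rewrite !gt_eqF.
apply: (@le_trans _ _ (expR (- (y / (M%:R + y))) ^+ M)).
  rewrite lerXn2r ?nnegrE ?expR_ge0 ?expR_ge1Dx //.
  by rewrite subr_ge0 ler_pdivrMr // mul1r; lra.
rewrite -expRM_natl ler_expR mulrN lerNl opprB mulrA ler_pdivlMr //.
rewrite expr2 in yM; nra.
Qed.

End Terms.

                                     

(** * Decoding the oracle answers *)

Lemma nth_flatten_block (T : Type) (x0 : T) (ss : seq (seq T)) r i t :
  (forall s, List.In s ss -> size s = r) -> (t < r)%N -> (i < size ss)%N ->
  nth x0 (flatten ss) (i * r + t) = nth x0 (nth [::] ss i) t.
Proof.
move=> + tr; elim: ss i => // s ss IH [|i] Hs isz /=.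
  by rewrite nth_cat Hs ?tr //; left.
rewrite nth_cat Hs; last by left.
rewrite mulSn -addnA ltnNge leq_addr /= addKn IH // => s' s's.
by apply: Hs; right.
Qed.

Lemma size_flatten_block (T : Type) (ss : seq (seq T)) r :
  (forall s, List.In s ss -> size s = r) -> size (flatten ss) = (size ss * r)%N.
Proof.
elim: ss => // s ss IH Hs /=; rewrite size_cat Hs; last by left.
by rewrite IH ?mulSn // => s' s's; apply: Hs; right.
Qed.

Lemma ler_divn (R : realFieldType) (a d : nat) : (0 < d)%N ->
  (a %/ d)%:R <= a%:R / d%:R :> R /\ a%:R / d%:R <= (a %/ d)%:R + 1 :> R.
Proof.
move=> d0; have d0' : (0 : R) < d%:R by rewrite ltr0n.
rewrite ler_pdivlMr // ler_pdivrMr // natr1 -!natrM !ler_nat leq_trunc_div.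
by split=> //; rewrite ltnW // ltn_ceil.
Qed.

Lemma ratr_sign (R : realType) (q : rat) :
  ratr q = (if q < 0 then - (`|numq q|%N%:R / `|denq q|%N%:R)
            else `|numq q|%N%:R / `|denq q|%N%:R) :> R.
Proof.
have dE : (`|denq q|%N%:R : R) = (denq q)%:~R.
  by rewrite -[in RHS](gez0_abs (ltW (denq_gt0 q))).
rewrite /ratr dE -numq_lt0; case: ltP => nq; last first.
  by rewrite -[in LHS](gez0_abs nq).
have -> : numq q = - (`|numq q|%N)%:Z by rewrite ltz0_abs // opprK.
by rewrite mulrNz mulNr abszN.
Qed.

Section Oracles.
Variables (R : realType) (A : finType) (X : set (fullshift A)).
Variables (psi : nat -> seq (seq A)) (chi : nat -> locpot A).
Variables (phi : fullshift A -> R).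
Hypothesis sX : subshift X.
Hypothesis X0 : X !=set0.
Hypothesis psiX : language_oracle X psi.
Hypothesis phi_bounded : exists C, forall x, X x -> `|phi x| <= C.
Hypothesis chiX : potential_oracle X phi chi.

Definition oracle_lists : list_oracle := fun o n =>
  match o with
  | Language => flatten [seq nats_of_word w | w <- psi n]
  | Potential => locpot_radius (chi n) ::
      flatten [seq nats_of_word e.1 ++ nats_of_rat e.2 | e <- locpot_table (chi n)]
  end.

Notation O := oracle_lists.

Lemma oraclesE : oracles psi chi = fun o n => code_nats (O o n).
Proof. by rewrite funeq2E => -[] n. Qed.

(** A bound on a supremum controls each point only if the set is bounded above; the finite table and
    the boundedness of [phi] ensure this. *)
Lemma locpot_close j x : X x ->
  `|ratr (locpot_val (chi j) x) - phi x| <= 2 ^- j.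
Proof.
move=> Xx; have [_ /ltW] := chiX j; apply: le_trans.
apply: ub_le_sup; last by exists x.
have [C HC] := phi_bounded.
exists (\sum_(e <- locpot_table (chi j)) `|ratr e.2| + C) => _ [y Xy <-].
rewrite (le_trans (ler_normB _ _)) // lerD ?HC // /locpot_val.
set i := index _ _; case: (ltnP i (size (locpot_table (chi j)))) => [isz|sz].
  by rewrite (big_nth ([::], 0)) big_mkord (bigD1 (Ordinal isz)) //= lerDl sumr_ge0.
by rewrite nth_default //= raddf0 normr0 sumr_ge0.
Qed.

Definition window (j : nat) (x : fullshift A) : seq A :=
  subword x (- (locpot_radius (chi j))%:Z) (locpot_radius (chi j)).*2.+1.

Definition entry (j : nat) (x : fullshift A) : nat :=
  index (window j x) (unzip1 (locpot_table (chi j))).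

Lemma entry_size j x : X x -> (entry j x < size (locpot_table (chi j)))%N.
Proof.
move=> Xx; rewrite -(size_map fst) index_mem.
apply/(chiX j).1.2; split; first exact: admissible_subword.
by rewrite size_subword.
Qed.

Lemma List_in (T : eqType) (x : T) s : List.In x s -> x \in s.
Proof.
elim: s => //= y s IH [->|/IH]; first by rewrite mem_head.
by rewrite inE => ->; rewrite orbT.
Qed.

Lemma size_table_word j p : p \in locpot_table (chi j) ->
  size p.1 = (locpot_radius (chi j)).*2.+1.
Proof.
by move=> pin; have [_ /(_ p.1)[/(_ (map_f _ pin))[]]] := (chiX j).1.
Qed.

Lemma size_table_block j s :
  List.In s [seq nats_of_word e.1 ++ nats_of_rat e.2 | e <- locpot_table (chi j)] ->
  size s = block O j.
Proof.
move=> /List.in_map_iff[p [<- /List_in pin]]; rewrite size_cat size_map.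
by rewrite (size_table_word pin) /block /pot_radius /= mul2n; lia.
Qed.

Lemma entriesE j : entries O j = size (locpot_table (chi j)).
Proof.
rewrite /entries /= (size_flatten_block (@size_table_block j)) size_map mulnK //.
by rewrite /block addnS.
Qed.

Lemma nth_table j e t : (e < size (locpot_table (chi j)))%N -> (t < block O j)%N ->
  let p := nth ([::], 0) (locpot_table (chi j)) e in
  nth 0%N (O Potential j) (e * block O j + t).+1
  = nth 0%N (nats_of_word p.1 ++ nats_of_rat p.2) t.
Proof.
move=> esz tb /=; rewrite (@nth_flatten_block _ _ _ (block O j)) ?size_map //.
  by rewrite (nth_map ([::], 0)).
exact: size_table_block.
Qed.

Lemma depth_words j w : w \in psi (depth O j) -> size w = word_length O j.
Proof. by move=> /psiX[_ ->]; rewrite /word_length mul2n. Qed.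

Lemma size_depth_words j s :
  List.In s [seq nats_of_word w | w <- psi (depth O j)] -> size s = word_length O j.
Proof.
by move=> /List.in_map_iff[w [<- /List_in /depth_words <-]]; rewrite size_map.
Qed.

Lemma wordsE j : words O j = size (psi (depth O j)).
Proof.
by rewrite /words /= (size_flatten_block (@size_depth_words j)) size_map mulnK.
Qed.

Lemma nth_nats_of_word (a : A) w t : (t < size w)%N ->
  nth 0%N (nats_of_word w) t = enum_rank (nth a w t).
Proof. exact: nth_map. Qed.

Lemma nth_words j u t (a : A) : (u < size (psi (depth O j)))%N ->
  (t < word_length O j)%N ->
  nth 0%N (O Language (depth O j)) (u * word_length O j + t)
  = enum_rank (nth a (nth [::] (psi (depth O j)) u) t).
Proof.
move=> usz tL; rewrite /= (@nth_flatten_block _ _ _ (word_length O j)) ?size_map //.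
  rewrite (nth_map [::]) // (nth_nats_of_word a) //.
  by rewrite (@depth_words j) // mem_nth.
exact: size_depth_words.
Qed.

Lemma enum_rank_neq (a b : A) :
  ((enum_rank a : nat) != enum_rank b) = (a != b).
Proof. by rewrite (inj_eq val_inj) (inj_eq enum_rank_inj). Qed.

Lemma sum_neq_eq0 (a : A) (w w' : seq A) n (f g : nat -> nat) :
  size w = n -> size w' = n ->
  (forall t, (t < n)%N -> f t = enum_rank (nth a w t)) ->
  (forall t, (t < n)%N -> g t = enum_rank (nth a w' t)) ->
  (\sum_(0 <= t < n) (f t != g t) == 0)%N = (w == w').
Proof.
move=> sw sw' Hf Hg; rewrite big_mkord sum_nat_eq0; apply/forallP/eqP.
  move=> H; apply: (@eq_from_nth _ a); rewrite ?sw ?sw' // => t tn.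
  have := H (Ordinal tn); rewrite /= Hf // Hg // enum_rank_neq eqb0 negbK.
  by move/eqP.
by move=> E t; rewrite /= Hf // Hg // E eqxx.
Qed.

Lemma freshE j u : (u < size (psi (depth O j)))%N ->
  fresh O j u = (index (nth [::] (psi (depth O j)) u) (psi (depth O j)) == u).
Proof.
move=> usz; set s := psi _ in usz *; rewrite /fresh big_mkord sum_nat_eq0.
have [x0 _] := X0; set a : A := x0 0.
have E v : (v < size s)%N -> (\sum_(0 <= t < word_length O j)
     (nth 0 (O Language (depth O j)) (v * word_length O j + t)
        != nth 0 (O Language (depth O j)) (u * word_length O j + t)) == 0)%N
    = (nth [::] s v == nth [::] s u).
  move=> vsz; apply: (@sum_neq_eq0 a).
  - by rewrite (@depth_words j) // mem_nth.
  - by rewrite (@depth_words j) // mem_nth.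
  - by move=> t tL; exact: nth_words.
  - by move=> t tL; exact: nth_words.
set w := nth [::] s u.
have iu : (index w s <= u)%N.
  by rewrite -ltnS index_ltn // (take_nth [::]) // mem_rcons mem_head.
apply/forallP/eqP => [H|Eu v]; last first.
  rewrite /= E ?(ltn_trans (ltn_ord v)) // eqb0; apply/negP => /eqP Ev.
  have vsz : (v < size s)%N := ltn_trans (ltn_ord v) usz.
  have : (index w s <= v)%N.
    by rewrite /w -Ev -ltnS index_ltn // (take_nth [::]) // mem_rcons mem_head.
  by rewrite Eu leqNgt ltn_ord.
apply/eqP; rewrite eqn_leq iu leqNgt; apply/negP => lt.
have := H (Ordinal lt); rewrite /= E ?(ltn_trans lt) // nth_index ?eqxx //.
by rewrite mem_nth.
Qed.

(** Through [index], the admissible words correspond bijectively to the fresh positions of the list,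
    so repetitions disappear. *)
Lemma sum_fresh j (F : nat -> R) :
  \sum_(0 <= u < words O j | fresh O j u) F u =
  \sum_(v : (word_length O j).-tuple A | `[< admissible X v >])
     F (index (v : seq A) (psi (depth O j))).
Proof.
set s := psi (depth O j); rewrite wordsE -big_filter.
have admE (v : (word_length O j).-tuple A) : admissible X v <-> (v : seq A) \in s.
  have sv : size v = (depth O j).*2.+1 by rewrite size_tuple /word_length mul2n.
  by split=> [av|/psiX[]//]; apply/psiX.
rewrite -[RHS]big_filter.
pose h (v : (word_length O j).-tuple A) := index (v : seq A) s.
rewrite -[RHS](big_map h xpredT F).
apply: perm_big; apply: uniq_perm.
- by rewrite filter_uniq // iota_uniq.
- rewrite map_inj_in_uniq ?filter_uniq ?index_enum_uniq // => v v'.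
  rewrite !mem_filter => /andP[/asboolP/admE vs _] /andP[/asboolP/admE vs' _].
  move=> /(congr1 (nth [::] s)); rewrite !nth_index // => /val_inj //.
move=> u; rewrite mem_filter mem_iota /= add0n subn0; apply/andP/mapP.
  move=> [fu usz]; have us : nth [::] s u \in s by rewrite mem_nth.
  exists (tcast (depth_words us) (in_tuple (nth [::] s u))).
    rewrite mem_filter mem_index_enum andbT; apply/asboolP/admE.
    by rewrite val_tcast.
  by rewrite /h val_tcast; move: fu; rewrite freshE // => /eqP.
move=> [v]; rewrite mem_filter => /andP[/asboolP/admE vs _] ->.
by rewrite freshE -/s ?index_mem // nth_index.
Qed.

Notation B := ((bound O)%:R : R).

Lemma entry_nth j x : X x ->
  nth ([::], 0) (locpot_table (chi j)) (entry j x) = (window j x, locpot_val (chi j) x).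
Proof.
move=> Xx; rewrite [LHS]surjective_pairing; congr (_, _).
rewrite -(nth_map ([::], 0) [::] fst) ?entry_size // nth_index //.
by rewrite -index_mem size_map entry_size.
Qed.

Lemma nth_entry_value j x t : X x -> (t < 3)%N ->
  nth 0%N (O Potential j) (entry j x * block O j + 2 * pot_radius O j + 2 + t)
  = nth 0%N (nats_of_rat (locpot_val (chi j) x)) t.
Proof.
move=> Xx t3; set k := pot_radius O j.
rewrite (_ : _ + t = (entry j x * block O j + ((2 * k).+1 + t)).+1)%N; last by lia.
rewrite nth_table ?entry_size //; last by rewrite /block -/k; lia.
rewrite entry_nth // nth_cat size_map size_subword -mul2n -/(pot_radius O j) -/k.
by rewrite ltnNge leq_addr /= addKn.
Qed.

Lemma nth_le_sum (l : seq nat) i :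
  (nth 0 l i <= \sum_(0 <= i < size l) nth 0 l i)%N.
Proof.
case: (ltnP i (size l)) => [il|li]; last by rewrite nth_default.
by rewrite big_mkord (bigD1 (Ordinal il)) //= leq_addr.
Qed.

(** A rational is at most its numerator in absolute value, that numerator is one of the numbers
    summed in [bound], and chi(0) is within 1 of [phi]. *)
Lemma norm_le_bound x : X x -> `|phi x| <= B.
Proof.
move=> Xx; set q := locpot_val (chi 0) x.
have qB : `|ratr q : R| <= (`|numq q|%N)%:R.
  have d1 : 1 <= (`|denq q|%N)%:R :> R by rewrite ler1n absz_gt0 denq_neq0.
  have H : (`|numq q|%N)%:R / (`|denq q|%N)%:R <= (`|numq q|%N)%:R :> R.
    by rewrite ler_pdivrMr ?(lt_le_trans ltr01) // ler_peMr ?ler0n.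
  by rewrite ratr_sign; case: ifP => _; rewrite ?normrN ger0_norm // divr_ge0.
have : (`|numq q| < bound O)%N.
  by have := nth_entry_value 0 Xx (isT : 1 < 3)%N; rewrite /= => <-; rewrite ltnS nth_le_sum.
rewrite -(ler_nat R) -natr1 => numB.
have := locpot_close 0 Xx; rewrite expr0 invr1 -/q => close.
have := ler_normB (ratr q) (ratr q - phi x); rewrite subKr => tri.
lra.
Qed.

Lemma entry_valueP j x : X x ->
  2 ^+ j * (phi x + B) <= (entry_value O j (entry j x))%:R /\
  (entry_value O j (entry j x))%:R <= 2 ^+ j * (phi x + B) + 4.
Proof.
move=> Xx; set q := locpot_val (chi j) x.
have phiB := norm_le_bound Xx.
have close := locpot_close j Xx; rewrite -/q in close.
have p0 : 0 < 2 ^+ j :> R by rewrite exprn_gt0.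
have close' : `|2 ^+ j * ratr q - 2 ^+ j * phi x| <= 1.
  by rewrite -mulrBr normrM gtr0_norm // -ler_pdivlMl // mulr1.
have phiB' : `|2 ^+ j * phi x| <= 2 ^+ j * B by rewrite normrM gtr0_norm // ler_pM2l.
have E0 := nth_entry_value j Xx (isT : 0 < 3)%N; rewrite addn0 /= in E0.
have E1 := nth_entry_value j Xx (isT : 1 < 3)%N; rewrite addn1 /= in E1.
have E2 := nth_entry_value j Xx (isT : 2 < 3)%N; rewrite addn2 /= in E2.
rewrite /entry_value /= E0 E1 E2 -/q.
move: (bound O) phiB phiB' => b phiB phiB'.
have d0 : (0 < `|denq q|)%N by rewrite absz_gt0 denq_neq0.
have [lo hi] := ler_divn R (`|numq q| * 2 ^ j) d0.
set v := (_ %/ _)%N in lo hi *.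
set r : R := _ / _ in lo hi.
have rE : 2 ^+ j * ratr q = (if q < 0 then - r else r).
  rewrite ratr_sign /r natrM natrX; case: ifP => _; last by rewrite mulrAC mulrC.
  by rewrite mulrN mulrAC mulrC.
rewrite mulrDr; move: close' phiB'; rewrite rE !ler_norml => /andP[c1 c2] /andP[b1 b2].
case: (q < 0) c1 c2 => c1 c2 /=; last first.
  by rewrite !natrD natrM natrX; split; lra.
(* For a negative rational, this makes the truncated subtraction in [entry_value] a true one. *)
have vB : (v <= b * 2 ^ j + 2)%N.
  rewrite -(ler_nat R) natrD natrM natrX; lra.
by rewrite natrB // natrD natrM natrX; split; lra.
Qed.

(** The table contains each admissible window exactly once, so a single term of the sum survives. *)
Lemma window_valueE j x p (a : A) : X x ->
  (forall t, (t < (2 * pot_radius O j).+1)%N ->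
     nth 0%N (O Language (depth O j)) (p + t) = enum_rank (nth a (window j x) t)) ->
  window_value O j p = entry_value O j (entry j x).
Proof.
move=> Xx Hp; rewrite /window_value entriesE big_mkord.
have mE e : (e < size (locpot_table (chi j)))%N -> matches O j e p = (e == entry j x).
  move=> esz; set s := unzip1 (locpot_table (chi j)).
  have uniq_s : uniq s by have [] := (chiX j).1.
  have sw : size (nth ([::], 0) (locpot_table (chi j)) e).1 = (2 * pot_radius O j).+1.
    by rewrite (@size_table_word j) ?mem_nth // mul2n.
  rewrite /matches (@sum_neq_eq0 a (nth ([::], 0) (locpot_table (chi j)) e).1 (window j x)).
  - rewrite -(nth_map _ [::] fst) // -/s; apply/eqP/eqP => [Ew|->].
      by rewrite /entry -/s -Ew index_uniq // size_map.
    by rewrite nth_index // -index_mem size_map entry_size.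
  - exact: sw.
  - by rewrite size_subword mul2n.
  - move=> t tk; rewrite nth_table //; last by rewrite /block; lia.
    by rewrite nth_cat size_map sw tk (nth_nats_of_word a) // sw.
  - exact: Hp.
rewrite (bigD1 (Ordinal (entry_size j Xx))) //= mE ?entry_size // eqxx mul1n.
rewrite big1 ?addn0 // => e /negPf ne; rewrite mE //.
by rewrite -[_ == _]/(e == Ordinal (entry_size j Xx)) ne.
Qed.

(** The L positions split as k + n + k. The middle ones have their window inside the word and cost
    an error of at most 4/2^j each; at the ends phi + B lies between 0 and 2B, and 2B was
    charged. *)
Lemma weightP j u x : X x -> (u < size (psi (depth O j)))%N ->
  nth [::] (psi (depth O j)) u = subword x 0 (word_length O j) ->
  let k := (pot_radius O j)%:R : R in let n := (windows O j)%:R : R in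
  let S := birkhoff_sum phi (word_length O j) x + (word_length O j)%:R * B in
  S <= (weight O j u)%:R / 2 ^+ j /\
  (weight O j u)%:R / 2 ^+ j <= S + 4 * k * B + 4 * n / 2 ^+ j.
Proof.
move=> Xx usz Eu k n S; set k' := pot_radius O j; set n' := windows O j.
have LE : word_length O j = (k' + (n' + k'))%N.
  by rewrite /word_length /depth /n' /windows -/k'; lia.
pose y i := shift_by (k' + i)%:Z x.
have Xy i : X (y i) by exact: shift_by_in.
have wE : (weight O j u = 4 * k' * bound O * 2 ^ j +
    \sum_(i < n') entry_value O j (entry j (y i)))%N.
  rewrite /weight -/k' -/n' big_mkord; congr (_ + _)%N; apply: eq_bigr => i _.
  apply: (@window_valueE j (y i) _ (x 0)) => // t tk.
  have itL : (i + t < word_length O j)%N.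
    by rewrite LE; have := ltn_ord i; rewrite -/k' in tk; lia.
  rewrite -addnA (nth_words (x 0)) // Eu nth_subword // nth_subword; last first.
    by rewrite -mul2n.
  congr (nat_of_ord (enum_rank _)); rewrite /y /shift_by; congr x.
  by rewrite -[locpot_radius _]/k'; lia.
have Bx i : `|phi (shift_by i x)| <= B by apply: norm_le_bound; exact: shift_by_in.
have p0 : 0 < 2 ^+ j :> R by rewrite exprn_gt0.
have SE : S = (\sum_(i < k') (phi (shift_by i%:Z x) + B)) +
   ((\sum_(i < n') (phi (y i) + B)) +
    \sum_(i < k') (phi (shift_by (k' + (n' + i))%:Z x) + B)).
  have sumDB m (f : 'I_m -> R) : \sum_(i < m) (f i + B) = \sum_(i < m) f i + m%:R * B.
    by rewrite big_split /= sumr_const card_ord mulr_natl.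
  rewrite !sumDB /S birkhoff_sumE LE.
  rewrite !big_split_ord /= (natrD _ k') (natrD _ n') !mulrDl; ring.
have edge (f : 'I_k' -> int) :
    0 <= \sum_(i < k') (phi (shift_by (f i) x) + B) <= 2 * k * B.
  rewrite sumr_ge0 /=; last first.
    by move=> i _; have := Bx (f i); rewrite ler_norml => /andP[]; lra.
  have -> : 2 * k * B = \sum_(i < k') (2 * B).
    by rewrite sumr_const card_ord -mulr_natl; rewrite /k -/k'; ring.
  by apply: ler_sum => i _; have := Bx (f i); rewrite ler_norml => /andP[]; lra.
have /andP[l1 l2] := edge (fun i => i%:Z).
have /andP[r1 r2] := edge (fun i => (k' + (n' + i))%:Z).
have W : (weight O j u)%:R / 2 ^+ j = 4 * k * B +
    \sum_(i < n') ((entry_value O j (entry j (y i)))%:R / 2 ^+ j) :> R.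
  rewrite wE natrD mulrDl !natrM natrX mulfK ?gt_eqF // natr_sum mulr_suml.
  by rewrite /k -/k'.
rewrite W SE.
have m1 : \sum_(i < n') (phi (y i) + B) <=
    \sum_(i < n') ((entry_value O j (entry j (y i)))%:R / 2 ^+ j).
  apply: ler_sum => i _; have [lo _] := entry_valueP j (Xy i).
  by rewrite ler_pdivlMr // mulrC.
have m2 : \sum_(i < n') ((entry_value O j (entry j (y i)))%:R / 2 ^+ j) <=
    \sum_(i < n') (phi (y i) + B) + 4 * n / 2 ^+ j.
  have -> : 4 * n / 2 ^+ j = \sum_(i < n') (4 / 2 ^+ j).
    by rewrite sumr_const card_ord -mulr_natl; rewrite /n -/n'; ring.
  rewrite -big_split /=; apply: ler_sum => i _; have [_ hi] := entry_valueP j (Xy i).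
  by rewrite ler_pdivrMr // mulrDl divfK ?gt_eqF // mulrC.
split; lra.
Qed.

(** * The integer test against the partition sum *)

Notation Z := (partition_sum X phi).

Definition word_index j (v : seq A) : nat := index v (psi (depth O j)).

Definition weight_sum j : R :=
  \sum_(v : (word_length O j).-tuple A | `[< admissible X v >])
     expR ((weight O j (word_index j v))%:R / 2 ^+ j).

Lemma word_index_lt j (v : (word_length O j).-tuple A) : admissible X v ->
  (word_index j v < size (psi (depth O j)))%N.
Proof.
move=> av; rewrite index_mem; apply/psiX; split=> //.
by rewrite size_tuple /word_length mul2n.
Qed.

Lemma nth_word_index j (v : (word_length O j).-tuple A) : admissible X v ->
  nth [::] (psi (depth O j)) (word_index j v) = v.
Proof. by move=> av; rewrite nth_index // -index_mem word_index_lt. Qed.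

Lemma weight_cylinder j (v : (word_length O j).-tuple A) x :
  admissible X v -> cylinder X v x ->
  let k := (pot_radius O j)%:R : R in let n := (windows O j)%:R : R in
  let S := birkhoff_sum phi (word_length O j) x + (word_length O j)%:R * B in
  let w := (weight O j (word_index j v))%:R / 2 ^+ j in
  S <= w /\ w <= S + 4 * k * B + 4 * n / 2 ^+ j.
Proof.
move=> av [Xx xv]; apply: weightP => //; first exact: word_index_lt.
by rewrite nth_word_index // -xv size_tuple.
Qed.

Lemma partition_le_weight_sum j :
  Z (word_length O j) * expR ((word_length O j)%:R * B) <= weight_sum j.
Proof.
rewrite /partition_sum mulr_suml; apply: ler_sum => v /asboolP av.
rewrite -expRD ler_expR -lerBrDr; apply: sup_cylinder_le => // x xv.
by have [lo _] := weight_cylinder av xv; rewrite lerBrDr.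
Qed.

Lemma weight_sum_le_partition j :
  weight_sum j <= Z (word_length O j) * expR ((word_length O j)%:R * B +
    4 * (pot_radius O j)%:R * B + 4 * (windows O j)%:R / 2 ^+ j).
Proof.
rewrite /partition_sum mulr_suml; apply: ler_sum => v /asboolP av.
rewrite -expRD ler_expR; have [x xv] := admissible_cylinder sX av.
have [_ hi] := weight_cylinder av xv; apply: (le_trans hi).
by rewrite !addrA !lerD2r; apply: (le_sup_cylinder sX norm_le_bound).
Qed.

Definition penalty j c u : R :=
  (1 + (slack O j c u)%:R / 2 ^+ j / (power O j c)%:R) ^- power O j c.

Lemma penalty_ge0 j c u : 0 <= penalty j c u.
Proof. by rewrite invr_ge0 exprn_ge0 // addr_ge0 // !divr_ge0 // exprn_ge0. Qed.

(** Multiplication by the product P of all (base + slack)^M turns the penalty of u into P with the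
    factor of u replaced by base^M. *)
Lemma passesE j c : passes O j c =
  (\sum_(v : (word_length O j).-tuple A | `[< admissible X v >])
     penalty j c (word_index j v) < 1).
Proof.
rewrite -(sum_fresh j (fun u => penalty j c u)) /passes -(ltr_nat R).
set K := base O j c; set M := power O j c; set P := (\prod_(0 <= v < _) (_ + _) ^ _)%N.
have K0 : (0 < K)%N by rewrite /K /base muln_gt0 expn_gt0.
have P0 : (0 < P)%N by rewrite prodn_gt0 // => v; rewrite expn_gt0 addn_gt0 K0.
rewrite -[in RHS](ltr_pM2l (x := P%:R)) ?ltr0n // mulr1 natr_sum mulr_sumr.
rewrite big_mkord [in RHS]big_mkord [in RHS]big_mkcond /=; congr (_ < _).
apply: eq_bigr => u _; case: (fresh _ _ _); last by rewrite mul0n.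
rewrite mul1n /P !big_mkord !natr_prod (bigD1 u) //= eqxx.
rewrite [in RHS](bigD1 u) //= mulrAC; congr (_ * _); last first.
  by apply: eq_bigr => v /negPf vu; rewrite (_ : (val v == val u) = false) // -vu.
rewrite /penalty -/M !natrX natrD -exprVn -exprMn; congr (_ ^+ _).
have M0 : (M%:R : R) != 0 by rewrite pnatr_eq0.
have K0' : (K%:R + (slack O j c u)%:R : R) != 0.
  by rewrite -natrD pnatr_eq0 addn_eq0 negb_and -lt0n K0.
have t0 : (2 ^+ j : R) != 0 by rewrite expf_neq0.
have KE : (K%:R : R) = M%:R * 2 ^+ j by rewrite /K /base natrM natrX.
rewrite KE in K0' *; field; by rewrite M0 t0 mulrC.
Qed.

Lemma slack_weight j c u : (0 < slack O j c u)%N ->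
  (slack O j c u)%:R / 2 ^+ j =
  (word_length O j)%:R * c%:R / 2 ^+ j - (weight O j u)%:R / 2 ^+ j :> R.
Proof.
by rewrite subn_gt0 => h; rewrite natrB ?(ltnW h) // natrM mulrBl.
Qed.

(** Each penalty is below 1, so every slack is positive and untruncated; then e^(-y) is at most the
    penalty. *)
Lemma passes_sound j c : passes O j c ->
  weight_sum j < expR ((word_length O j)%:R * c%:R / 2 ^+ j).
Proof.
rewrite passesE => Hsum; set t := _ / _.
rewrite -[ltRHS]mulr1 -ltr_pdivrMl ?expR_gt0 //; apply: (le_lt_trans _ Hsum).
rewrite mulr_sumr; apply: ler_sum => v av.
have pen1 : penalty j c (word_index j v) < 1.
  apply: (le_lt_trans _ Hsum); rewrite (bigD1 v) //= lerDl.
  by apply: sumr_ge0 => w _; exact: penalty_ge0.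
have s0 : (0 < slack O j c (word_index j v))%N.
  rewrite lt0n; apply/eqP => s0; move: pen1.
  by rewrite /penalty s0 !mul0r addr0 expr1n invr1 ltxx.
apply: le_trans (expRN_le_pow _ (ltn0Sn _)); last by rewrite divr_ge0 ?exprn_ge0.
by rewrite slack_weight // opprB expRD expRN mulrC.
Qed.

(** The hypothesis already puts each single term below exp(L c/2^j), so the slacks are positive; the
    factor e pays for the loss in penalty <= e^(1-y). *)
Lemma passes_complete j c :
  weight_sum j * expR 1 < expR ((word_length O j)%:R * c%:R / 2 ^+ j) ->
  passes O j c.
Proof.
set t := _ * _ / _ => Wt; rewrite passesE.
have p0 : 0 < 2 ^+ j :> R by rewrite exprn_gt0.
have e1 : 1 <= expR 1 :> R by rewrite -expR0 ler_expR.
suff H v : `[< admissible X (v : (word_length O j).-tuple A) >] ->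
    penalty j c (word_index j v) <=
    expR (1 - t) * expR ((weight O j (word_index j v))%:R / 2 ^+ j).
  apply: le_lt_trans (ler_sum _ H) _; rewrite -mulr_sumr expRD expRN.
  by rewrite mulrAC -/(weight_sum j) ltr_pdivrMr ?expR_gt0 // mul1r mulrC.
move=> av.
have wW : expR ((weight O j (word_index j v))%:R / 2 ^+ j) <= weight_sum j.
  rewrite /weight_sum (bigD1 v) //= lerDl.
  by apply: sumr_ge0 => w _; exact: expR_ge0.
have s0 : (0 < slack O j c (word_index j v))%N.
  rewrite subn_gt0 -(ltr_nat R) natrM -(ltr_pM2r (x := 2 ^- j)) ?invr_gt0 //.
  rewrite -ltr_expR -/t; apply: le_lt_trans wW (le_lt_trans _ Wt).
  by rewrite ler_peMr // sumr_ge0 // => w _; exact: expR_ge0.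
rewrite -expRD -addrA [- t + _]addrC -opprB /t -slack_weight //.
apply: pow_le_expRN => //.
(* Here y <= L c, hence y^2 <= (L c)^2 < M. *)
apply: (@le_trans _ _ ((word_length O j * c)%:R ^+ 2)); last first.
  by rewrite -natrX ler_nat /power leqnSn.
rewrite lerXn2r ?nnegrE ?divr_ge0 // ?(ltW p0) //.
rewrite ler_pdivrMr // -natrX -natrM ler_nat.
by rewrite (leq_trans (leq_subr _ _)) // leq_pmulr // expn_gt0.
Qed.

Let Z_gt0 n : 0 < Z n := partition_sum_gt0 sX X0 norm_le_bound n.

Lemma exp2_gt j : (j.+1)%:R <= 2 ^+ j :> R.
Proof. by rewrite -natrX ler_nat ltn_expl. Qed.

(** If c passes, then Z(L) e^(L B) < e^(L c/2^j), so c/2^j > ln Z(L)/L + B >= p + B. Hence every c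
    below (p + B) 2^j fails. *)
Lemma level_ge p j : (forall n, (0 < n)%N -> p * n%:R <= ln (Z n)) ->
  (p + B) * 2 ^+ j <= (level #|A| O j)%:R.
Proof.
move=> pZ; have p0 : 0 < 2 ^+ j :> R by rewrite exprn_gt0.
apply: count_ge => [|c cx].
  rewrite natrM natrX natrD natrM [leRHS]mulrC ler_pM2r //.
  (* The range of c is long enough: p <= ln Z(1) <= ln #|A| + B <= #|A| + B. *)
  suff : p <= B + #|A|%:R by lra.
  have := pZ 1%N isT; rewrite mulr1 => /le_trans; apply.
  have A0 : (0 : R) < #|A|%:R.
    by have [x _] := X0; rewrite ltr0n; apply/card_gt0P; exists (x 0).
  apply: (@le_trans _ _ (ln (#|A|%:R * expR B))).
    rewrite ler_ln ?posrE ?mulr_gt0 ?expR_gt0 //.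
    exact: (partition_sum1 sX norm_le_bound).
  rewrite lnM ?posrE ?expR_gt0 // expRK addrC lerD2l ltW //.
  exact: ln_sublinear.
apply/negP => /passes_sound /(le_lt_trans (partition_le_weight_sum j)).
rewrite -[X in X * _]lnK ?posrE // -expRD ltr_expR => lt.
have L0 : (0 < word_length O j)%N by [].
have L0' : (0 : R) < (word_length O j)%:R by rewrite ltr0n.
have := pZ _ L0; apply/negP; rewrite -ltNge.
have : (word_length O j)%:R * (c%:R / 2 ^+ j) < (word_length O j)%:R * (p + B).
  by rewrite ltr_pM2l // ltr_pdivrMr.
rewrite mulrA; lra.
Qed.

(** Over j+1, the constant collects 2B for the ends of the words, 4 for the oracle and rounding
    errors, 1 for the factor e lost by the test, and 1 for the grid 2^(-j) of the values c/2^j. *)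
Lemma level_le j : (level #|A| O j)%:R / 2 ^+ j <=
  ln (Z (word_length O j)) / (word_length O j)%:R + B + (2 * B + 6) / (j.+1)%:R.
Proof.
have p0 : 0 < 2 ^+ j :> R by rewrite exprn_gt0.
have j0 : (0 : R) < (j.+1)%:R by rewrite ltr0n.
have L0 : (0 : R) < (word_length O j)%:R by rewrite ltr0n.
have B0 : 0 <= B by [].
set L := (word_length O j)%:R in L0 *; set z := ln _.
set k := (pot_radius O j)%:R : R; set n := (windows O j)%:R : R.
pose E := z + L * B + 4 * k * B + 4 * n / 2 ^+ j + 1.
have W_le : weight_sum j * expR 1 <= expR E.
  have H : weight_sum j <= expR z * expR (L * B + 4 * k * B + 4 * n / 2 ^+ j).
    by rewrite lnK ?posrE //; exact: weight_sum_le_partition.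
  rewrite /E expRD ler_pM2r ?expR_gt0 //; apply: (le_trans H).
  by rewrite -expRD !addrA.
have zL : 0 <= z + L * B.
  have := partition_sum_ge sX X0 norm_le_bound (word_length O j).
  rewrite -[leRHS]lnK ?posrE // ler_expR -/z -/L mulNr [B * L]mulrC; lra.
have E0 : 0 <= E.
  have h1 : 0 <= 4 * k * B by rewrite !mulr_ge0.
  have h2 : 0 <= 4 * n / 2 ^+ j by rewrite divr_ge0 ?mulr_ge0 ?(ltW p0).
  rewrite /E; lra.
have lev : (level #|A| O j)%:R <= E * 2 ^+ j / L + 1.
  apply: count_le => [|c]; first by rewrite divr_ge0 ?mulr_ge0 ?E0 ?(ltW p0) ?(ltW L0).
  move=> /negP npass; rewrite leNgt; apply/negP => lt; apply: npass.
  apply: passes_complete; apply: (le_lt_trans W_le).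
  rewrite ltr_expR -/L ltr_pdivlMr //.
  by move: lt; rewrite ltr_pdivrMr // [c%:R * L]mulrC.
have jk : 2 * k * (j.+1)%:R <= L.
  rewrite /k /L -[2]/(2%:R) -!natrM ler_nat /word_length /depth; nia.
have jL : (j.+1)%:R <= L by rewrite /L ler_nat /word_length /depth; nia.
have nL : n <= L by rewrite /n /L ler_nat /windows /word_length /depth; nia.
have i2 : (2 ^+ j)^-1 <= 1 / (j.+1)%:R :> R by rewrite mul1r lef_pV2 ?posrE // exp2_gt.
have -> : (2 * B + 6) / (j.+1)%:R = 2 * B / (j.+1)%:R + 4 / (j.+1)%:R +
    1 / (j.+1)%:R + 1 / (j.+1)%:R :> R by field; rewrite gt_eqF.
apply: (@le_trans _ _ (E / L + (2 ^+ j)^-1)).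
  rewrite ler_pdivrMr // mulrDl mulVf ?gt_eqF //.
  by rewrite (le_trans lev) // mulrAC.
have -> : E / L = z / L + B + 4 * k * B / L + 4 * n / 2 ^+ j / L + 1 / L.
  by rewrite /E; field; rewrite !gt_eqF.
have h1 : 4 * k * B / L <= 2 * B / (j.+1)%:R.
  rewrite ler_pdivrMr // [leRHS]mulrAC ler_pdivlMr //.
  have := ler_wpM2l (_ : 0 <= 2 * B) jk; rewrite mulr_ge0 // => /(_ isT).
  lra.
have h2 : 4 * n / 2 ^+ j / L <= 4 / (j.+1)%:R.
  rewrite ler_pdivrMr //; apply: (@le_trans _ _ (4 / (j.+1)%:R * n)).
    by rewrite mulrAC ler_wpM2r // ler_pM2l // -[leRHS]mul1r.
  by rewrite ler_wpM2l // divr_ge0 // ltW.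
have h3 : 1 / L <= 1 / (j.+1)%:R by rewrite !mul1r lef_pV2 ?posrE.
by rewrite !addrA; apply: lerD i2; apply: lerD h3; apply: lerD h2; apply: lerD h1.
Qed.

(** * The sequence of outputs and its limit *)

Lemma best_le n : (best #|A| O n <= level #|A| O n)%N.
Proof. by case: n => // n; exact: geq_minr. Qed.

Lemma best_step n : (best #|A| O n.+1 <= 2 * best #|A| O n)%N.
Proof. exact: geq_minl. Qed.

Lemma best_ge p n : (forall n, (0 < n)%N -> p * n%:R <= ln (Z n)) ->
  (p + B) * 2 ^+ n <= (best #|A| O n)%:R.
Proof.
move=> pZ; elim: n => [|n IH]; first exact: level_ge.
rewrite /best iteriS -/(best #|A| O n) /minn; case: ifP => _.
  by rewrite natrM exprS mulrCA ler_pM2l.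
exact: level_ge.
Qed.

Definition approximation n : rat :=
  ((out_num #|A| O n)%:Z - (out_shift O n)%:Z)%:~R / (out_den n)%:Z%:~R.

(** [out_num] is odd and [out_shift] even, so the fraction over a power of 2 is in lowest terms, and
    [numq] and [denq] are the numbers computed. *)
Lemma nats_of_approximation n : nats_of_rat (approximation n) =
  [:: nat_of_bool (out_num #|A| O n < out_shift O n)%N;
      (out_num #|A| O n - out_shift O n) + (out_shift O n - out_num #|A| O n);
      out_den n]%N.
Proof.
set a := out_num #|A| O n; set b := out_shift O n; set d := out_den n.
have d0 : (0 < d)%N by rewrite expn_gt0.
have aE : (`|a%:Z - b%:Z| = (a - b) + (b - a))%N by lia.
have co : coprime `|a%:Z - b%:Z| `|d%:Z|.
  rewrite absz_nat /d /out_den coprimeXr // coprimen2 aE.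
  have ob : odd b = false by rewrite /b /out_shift /out_den expnS oddM oddM /= andbF.
  have oa : odd a by rewrite /a /out_num /= oddM.
  rewrite oddD; case: (leqP a b) => ab; last first.
    by rewrite oddB 1?ltnW // oa ob (_ : b - a = 0)%N //; lia.
  by rewrite (oddB ab) oa ob (_ : a - b = 0)%N //; lia.
rewrite /nats_of_rat /approximation -/a -/b -/d coprimeq_num // coprimeq_den //.
rewrite gtr0_sg ?ltz_nat // mul1r aE eqz_nat gtn_eqF //=.
congr [:: nat_of_bool _; _; _].
rewrite pmulr_llt0 ?invr_gt0 ?ltr0z ?ltz_nat // ltrz0; lia.
Qed.

Lemma ratr_approximation n : ratr (approximation n) =
  (best #|A| O n)%:R / 2 ^+ n + 2 ^- n.+1 - B :> R.
Proof.
rewrite /approximation /out_num /out_shift /out_den rmorphM fmorphV /= !ratr_int.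
rewrite intrD intrN -!pmulrn -natr1 !natrM natrX exprS.
by field; rewrite expf_neq0.
Qed.

Lemma approximation_nonincreasing : nonincreasing_seq approximation.
Proof.
apply/nonincreasing_seqP => n; rewrite -(ler_rat R) !ratr_approximation.
have p0 : 0 < 2 ^+ n :> R by rewrite exprn_gt0.
have b : (best #|A| O n.+1)%:R <= 2 * (best #|A| O n)%:R :> R.
  by rewrite -natrM ler_nat best_step.
have b' : (best #|A| O n.+1)%:R / 2 ^+ n.+1 <= (best #|A| O n)%:R / 2 ^+ n :> R.
  rewrite exprS ler_pdivrMr ?mulr_gt0 // [2 * _]mulrC mulrA divfK ?gt_eqF //.
  by rewrite mulrC.
have d : 2 ^- n.+2 <= 2 ^- n.+1 :> R.
  by rewrite lef_pV2 ?posrE ?exprn_gt0 // ler_eXn2l // ltr1n.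
lra.
Qed.

(** Squeezed between p and ln Z(L)/L + O(1/(n+1)), where L tends to infinity with n. *)
Lemma approximation_cvg :
  (ratr (approximation n) : R)%:E @[n --> \oo] --> pressure X phi.
Proof.
have [p [-> pZ cp]] := pressure_lim sX X0 norm_le_bound.
apply: cvg_EFin; first exact: nearW.
(* 7 is the 6 of [level_le] plus 1 for the term 2^(-n-1) of the output. *)
pose u n : R := ln (Z (word_length O n)) / (word_length O n)%:R +
  (2 * B + 7) / (n.+1)%:R.
apply: (@squeeze_cvgr _ _ _ _ (fun=> p) u).
- apply: nearW => n /=; rewrite ratr_approximation.
  have p0 : 0 < 2 ^+ n :> R by rewrite exprn_gt0.
  apply/andP; split.
    have := best_ge n pZ; rewrite -ler_pdivlMr // => h.
    have : 0 <= 2 ^- n.+1 :> R by rewrite invr_ge0 exprn_ge0.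
    lra.
  have b : (best #|A| O n)%:R / 2 ^+ n <= (level #|A| O n)%:R / 2 ^+ n :> R.
    by rewrite ler_pM2r ?invr_gt0 // ler_nat best_le.
  have h : 2 ^- n.+1 <= 1 / (n.+1)%:R :> R.
    rewrite mul1r lef_pV2 ?posrE ?exprn_gt0 ?ltr0n //.
    by rewrite (le_trans _ (exp2_gt _)) // ler_nat.
  have -> : u n = ln (Z (word_length O n)) / (word_length O n)%:R +
    ((2 * B + 6) / (n.+1)%:R + 1 / (n.+1)%:R).
    by rewrite /u -mulrDl; congr (_ + _ / _); lra.
  rewrite lerBlDr (le_trans (lerD (le_trans b (level_le n)) h)) //.
  by rewrite [leRHS]addrAC !addrA.
- exact: cvg_cst.
- rewrite -[p]addr0; apply: cvgD; last first.
    rewrite -[0](mulr0 (2 * B + 7)); apply: cvgM; first exact: cvg_cst.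
    exact: cvg_harmonic.
  have cL : word_length O n @[n --> \oo] --> \oo.
    apply/cvgnyPge => m; near=> n.
    apply: (@leq_trans n); first by near: n; exact: nbhs_infty_ge.
    by rewrite /word_length /depth; nia.
  exact: (cvg_comp _ _ cL cp).
Unshelve. all: by end_near.
Qed.

End Oracles.

                                                

(** * The empty subshift, and the conclusion *)

Lemma pressure_set0 (R : realType) (A : finType) (phi : fullshift A -> R) :
  pressure set0 phi = -oo%E.
Proof.
apply: cvg_lim => //.
have Z0 n : partition_sum set0 phi n = 0.
  by rewrite /partition_sum big1 // => w /asboolP[].
(* The sequence is constant only from n = 1 on: at n = 0 the term is 0 times -oo, that is 0. *)
apply: cvg_near_cst; near=> n; apply/eqP.
rewrite Z0 le0_lneNy // gt0_muleNy // lte_fin invr_gt0 ltr0n.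
by near: n; exact: nbhs_infty_gt.
Unshelve. all: by end_near.
Qed.

Lemma opposite_cvg (R : realType) :
  (ratr (- n%:Q) : R)%:E @[n --> \oo] --> -oo%E.
Proof.
apply/cvgeNyPle => M; near=> n.
rewrite rmorphN /= ratr_int lee_fin lerNl.
by near: n; exact: nbhs_infty_ger.
Unshelve. all: by end_near.
Qed.

Lemma nats_of_opposite (n : nat) : nats_of_rat (- n%:Q) = [:: nat_of_bool (0 < n)%N; n; 1%N].
Proof.
rewrite /nats_of_rat oppr_lt0 ltr0n -[- _](rmorphN (intr : int -> rat)).
by rewrite numq_int denq_int abszN absz_nat.
Qed.

Theorem proposition24 (R : realType) (A : finType) (X : set (fullshift A))
    (psi : nat -> seq (seq A)) :
  subshift X -> language_oracle X psi ->
  upper_semicomputable X psi (@pressure R A X).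
Proof.
(* The machine may depend on [X], so emptiness is decided classically; a point of [X] is what keeps
   Z(n) positive and the pressure finite. *)
move=> sX psiX; have [X0|/set0P/negP/negPn/eqP ->] := pselect (X !=set0).
  have [M HM] := machine_algorithm #|A|; exists M => phi cphi chi chiX.
  have bounded_phi := subshift_bounded sX.1 cphi.
  exists (approximation psi chi); split.
  - by move=> n; rewrite oraclesE nats_of_approximation; exact: HM.
  - exact: (approximation_nonincreasing R).
  - exact: (approximation_cvg sX X0 psiX bounded_phi chiX).
have [M HM] := machine_opposite; exists M => phi _ chi _.
exists (fun n => - n%:Q); split.
- by move=> n; rewrite oraclesE nats_of_opposite; exact: HM.
- by apply/nonincreasing_seqP => n; rewrite lerN2 ler_nat.
- by rewrite pressure_set0; exact: opposite_cvg.
Qed.
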